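(* Let $(X,|\cdot|)$ be a Banach space and let $r\ge 0$ be an integer. Let $A_j(n)\in\mathcal L(X)$, $n\in\mathbb Z^+_0$, $0\le j\le r$, be compact linear operators which are uniformly bounded, i.e., there exists $K\ge 1$ such that $|A_j(n)|\le K$ for all $n\in\mathbb Z^+_0$ and $0\le j\le r$. Consider the nonautonomous linear delay difference equation $$x(n+1)=\sum_{j=0}^r A_j(n)\,x(n-j).\qquad (\ast)$$ Then the following statements are equivalent: (i) Equation $(\ast)$ is shadowable on $\mathbb Z^+_0$; (ii) Equation $(\ast)$ admits an exponential dichotomy (on $\mathbb Z^+_0$).
   Context: Notation. For $k\in\mathbb Z$, $\mathbb Z^+_k=\{n\in\mathbb Z: n\ge k\}$. $\mathcal L(X)$ is the space of bounded linear operators on $X$ with the operator norm, also denoted $|\cdot|$. A linear operator $A\colon X\to X$ is compact if the image of every bounded set has compact closure. Phase space. $\mathcal B_r$ is the Banach space of all functions $\phi\colon[-r,0]\cap\mathbb Z\to X$ with norm $\|\phi\|=\max_{-r\le\theta\le0}|\phi(\theta)|$. For a function $x$ with values in $X$ defined on $\{n-r,\dots,n\}$, the segment $x_n\in\mathcal B_r$ is $x_n(\theta)=x(n+\theta)$, $\theta\in[-r,0]\cap\mathbb Z$. For $n\in\mathbb Z_0^+$, $L_n\colon\mathcal B_r\to X$ is the bounded linear map $L_n(\phi)=\sum_{j=0}^rA_j(n)\phi(-j)$, so that $(\ast)$ reads $x(n+1)=L_n(x_n)$. Solutions. Given $m\in\mathbb Z^+_0$ and $\phi\in\mathcal B_r$,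 there is a unique function $x\colon\mathbb Z^+_{m-r}\to X$ satisfying $(\ast)$ for all $n\ge m$ and $x_m=\phi$; it is called the solution of $(\ast)$ with initial value $x_m=\phi$. A solution of $(\ast)$ on $\mathbb Z^+_m$ is a solution with initial value $x_m=\phi$ for some $\phi\in\mathcal B_r$. For $n\ge m\ge0$ the solution operator $T(n,m)\colon\mathcal B_r\to\mathcal B_r$ is $T(n,m)\phi=x_n$, where $x$ is the solution with $x_m=\phi$. Shadowing. Equation $(\ast)$ is shadowable on $\mathbb Z^+_0$ if for each $\epsilon>0$ there exists $\delta>0$ such that for every function $y\colon\mathbb Z^+_{-r}\to X$ satisfying $\sup_{n\ge0}|y(n+1)-L_n(y_n)|\le\delta$ there exists a solution $x$ of $(\ast)$ on $\mathbb Z^+_0$ such that $\sup_{n\ge0}\|x_n-y_n\|\le\epsilon$. Exponential dichotomy. Equation $(\ast)$ admits an exponential dichotomy (on $\mathbb Z^+_0$) if there exist a sequence of projections $(P_n)_{n\in\mathbb Z^+_0}$ on $\mathcal B_r$ and constants $D,\lambda>0$ such that: (1) for $n\ge m\ge0$, $P_nT(n,m)=T(n,m)P_m$, and the restriction $T(n,m)|_{\ker P_m}\colon\ker P_m\to\ker P_n$ is onto and invertible; (2) for $n\ge m\ge0$, $\|T(n,m)P_m\|\le De^{-\lambda(n-m)}$; (3) for $0\le n\le m$, $\|T(n,m)Q_m\|\le De^{-\lambda(m-n)}$, where $Q_m=I-P_m$ ($I$ the identity on $\mathcal B_r$) and, for $n\le m$, $T(n,m):=\bigl(T(m,n)|_{\ker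 P_n}\bigr)^{-1}\colon\ker P_m\to\ker P_n$. *)

(* Defs.v *)
From HB Require Import structures.
From mathcomp Require Import all_boot all_order all_algebra.
From mathcomp Require Import complex.
From mathcomp Require Import interval_inference zify.
From mathcomp Require Import all_classical all_reals all_analysis.

Set Implicit Arguments.
Unset Strict Implicit.
Unset Printing Implicit Defensive.
Import Order.TTheory GRing.Theory Num.Theory.
Import numFieldNormedType.Exports.
Local Open Scope classical_set_scope.
Local Open Scope ring_scope.

(* A Banach space may be real or complex. In MathComp the norm of a space over
   K takes its values in K, so [ofR] is the inclusion of the reals in the
   scalar field; it is used to compare norms with real constants. *)
Inductive real_or_complex (R : realType) :
    forall K : numFieldType, (R -> K) -> Prop :=
| Real_scalars : @real_or_complex R R id
| Complex_scalars : @real_or_complex R R[i] (real_complex R).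

(* [opnorm_le f c] is the bound ‖f‖ <= c on the operator norm. *)
Definition opnorm_le (K : numFieldType) (V W : normedModType K)
  (f : V -> W) (c : K) : Prop := forall v, `|f v| <= c * `|v|.

Definition compact_operator (K : numFieldType) (V W : normedModType K)
  (f : V -> W) : Prop :=
  forall B : set V, bounded_set B -> compact (closure (f @` B)).

(* The phase space B_r: a function phi on {-r, ..., 0} is encoded by
   j |-> phi (- j), for 0 <= j <= r. *)
Definition phase (K : numFieldType) (X : normedModType K) (r : nat) : Type :=
  {ffun 'I_r.+1 -> X}.

Section PhaseNorm.
Context {K : numFieldType} {X : normedModType K} {r : nat}.

HB.instance Definition _ := GRing.Lmodule.copy (phase X r) {ffun 'I_r.+1 -> X}.

Definition phase_norm (phi : phase X r) : K :=
  (\big[Num.max/0%:nng]_(j < r.+1) `|phi j|%:nng)%:num.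

Lemma phase_norm_leP (phi : phase X r) (c : K) : 0 <= c ->
  phase_norm phi <= c <-> forall j, `|phi j| <= c.
Proof.
move=> c0; rewrite -[c]/((NngNum c0)%:num) /phase_norm num_le.
split=> [/bigmax_leP[_ h] j|h]; first by have := h j isT.
by apply/bigmax_leP; split=> [|j _]; rewrite -num_le //=.
Qed.

Lemma phase_norm_ge0 (phi : phase X r) : 0 <= phase_norm phi.
Proof. by rewrite /phase_norm. Qed.

Lemma le_phase_norm (phi : phase X r) j : `|phi j| <= phase_norm phi.
Proof. exact: (phase_norm_leP _ (phase_norm_ge0 phi)).1. Qed.

Lemma phase_normD (phi psi : phase X r) :
  phase_norm (phi + psi) <= phase_norm phi + phase_norm psi.
Proof.
apply/phase_norm_leP => [|j]; first by rewrite addr_ge0 ?phase_norm_ge0.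
rewrite ffunE (le_trans (ler_normD _ _))//.
by apply: lerD; exact: le_phase_norm.
Qed.

Lemma phase_normZ (l : K) (phi : phase X r) :
  phase_norm (l *: phi) = `|l| * phase_norm phi.
Proof.
have le k (f : phase X r) : phase_norm (k *: f) <= `|k| * phase_norm f.
  apply/phase_norm_leP => [|j]; first by rewrite mulr_ge0 ?phase_norm_ge0.
  by rewrite ffunE normrZ ler_wpM2l// le_phase_norm.
apply/eqP; rewrite eq_le le /=.
have [->|l0] := eqVneq l 0; first by rewrite normr0 mul0r phase_norm_ge0.
rewrite mulrC -ler_pdivlMr ?normr_gt0// mulrC -normfV.
by rewrite (le_trans _ (le l^-1 _))// scalerA mulVf// scale1r.
Qed.

Lemma phase_norm_eq0 (phi : phase X r) : phase_norm phi = 0 -> phi = 0.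
Proof.
move=> h; apply/ffunP => j; rewrite ffunE; apply/eqP.
by rewrite -normr_le0 -h le_phase_norm.
Qed.

HB.instance Definition _ := @Lmodule_isNormed.Build K (phase X r)
  phase_norm phase_normD phase_normZ phase_norm_eq0.

End PhaseNorm.

Section DelayEquation.
Context {K : numFieldType} {X : normedModType K} {r : nat}.
Variable A : 'I_r.+1 -> nat -> {linear X -> X}.

(* Functions on {n : n >= m - r} are encoded as functions on int whose values
   below m - r are irrelevant. *)
Definition segment (x : int -> X) (n : nat) : phase X r :=
  [ffun j : 'I_r.+1 => x (n%:Z - j%:Z)].

Definition delay_map (n : nat) (phi : phase X r) : X :=
  \sum_(j < r.+1) A j n (phi j).

Definition is_solution (m : nat) (x : int -> X) : Prop :=
  forall n : nat, (m <= n)%N -> x (n.+1)%:Z = delay_map n (segment x n).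

Lemma solution_exists (m : nat) (phi : phase X r) :
  exists x, is_solution m x /\ segment x m = phi.
Proof.
pose fix s k : phase X r := if k is k'.+1 then
  [ffun j : 'I_r.+1 => if j == ord0 then delay_map (m + k')%N (s k')
                       else s k' (inord j.-1)] else phi.
pose x (t : int) := if (t < m%:Z)%R then phi (inord (absz (m%:Z - t)%R))
                    else s (absz (t - m%:Z)%R) ord0.
have segx k : segment x (m + k)%N = s k.
  elim: k => [|k IH]; apply/ffunP => j; rewrite ffunE.
    rewrite addn0 /x; have [j0|j0] := eqVneq j ord0.
      by rewrite j0 subr0 ltxx subrr.
    have jgt : (0 < j)%N by rewrite lt0n.
    have -> : (m%:Z - j%:Z < m%:Z) = true by lia.
    have -> : absz (m%:Z - (m%:Z - j%:Z))%R = j by lia.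
    by rewrite inord_val.
  rewrite [RHS]ffunE; have [->|j0] := eqVneq j ord0.
    rewrite subr0 /x.
    have -> : ((m + k.+1)%N%:Z < m%:Z) = false by lia.
    have -> : absz ((m + k.+1)%N%:Z - m%:Z)%R = k.+1 by lia.
    by rewrite /= ffunE eqxx.
  have jgt : (0 < j)%N by rewrite lt0n.
  have := congr1 (fun f : phase X r => f (inord j.-1)) IH.
  rewrite /= ffunE inordK; last by rewrite (leq_ltn_trans (leq_pred _)).
  by move=> IHj; apply: etrans IHj; congr x; lia.
exists x; split; last by rewrite -[m in LHS]addn0 segx.
move=> n mn; have /= := congr1 (fun f : phase X r => f ord0) (segx (n - m).+1).
by rewrite !ffunE subr0 eqxx addnS subnKC// -segx subnKC.
Qed.

Lemma solution_unique (m : nat) (x y : int -> X) :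
  is_solution m x -> is_solution m y -> segment x m = segment y m ->
  forall t : int, m%:Z - r%:Z <= t -> x t = y t.
Proof.
move=> solx soly xy.
have segE k : segment x (m + k)%N = segment y (m + k)%N.
  elim: k => [|k IH]; first by rewrite addn0.
  apply/ffunP => j; rewrite !ffunE; have [->|j0] := eqVneq j ord0.
    by rewrite !subr0 addnS solx ?soly ?leq_addr// IH.
  have jgt : (0 < j)%N by rewrite lt0n.
  have jr : (j.-1 < r.+1)%N by rewrite (leq_ltn_trans (leq_pred _)).
  have := congr1 (fun f : phase X r => f (Ordinal jr)) IH.
  rewrite !ffunE /=.
  by have -> : (m + k.+1)%N%:Z - j%:Z = (m + k)%N%:Z - j.-1%:Z by lia.
move=> t tm; have [mt|tm'] := leP m%:Z t.
  have := congr1 (fun f : phase X r => f ord0) (segE (absz (t - m%:Z)%R)).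
  rewrite !ffunE subr0.
  by have -> : (m + absz (t - m%:Z)%R)%N%:Z = t by lia.
have jr : (absz (m%:Z - t)%R < r.+1)%N by lia.
have := congr1 (fun f : phase X r => f (Ordinal jr)) xy.
rewrite !ffunE /=.
by have -> : m%:Z - (absz (m%:Z - t)%R)%:Z = t by lia.
Qed.

Definition solution (m : nat) (phi : phase X r) : int -> X :=
  xget (fun=> 0) [set x | is_solution m x /\ segment x m = phi].

Lemma solutionP (m : nat) (phi : phase X r) :
  is_solution m (solution m phi) /\ segment (solution m phi) m = phi.
Proof.
have [x hx] := solution_exists m phi.
exact: (xgetPex (fun=> 0) (P := [set x | is_solution m x /\
  segment x m = phi]) (ex_intro _ x hx)).
Qed.

(* T(n, m), meant for n >= m. *)
Definition solution_op (n m : nat) (phi : phase X r) : phase X r :=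
  segment (solution m phi) n.

Definition ker (f : phase X r -> phase X r) : set (phase X r) :=
  [set phi | f phi = 0].

(* T(n, m) for n <= m, the inverse of T(m, n) : ker (P n) -> ker (P m). *)
Definition solution_op_back (P : nat -> phase X r -> phase X r) (n m : nat) :
    phase X r -> phase X r :=
  'pinv_(fun=> 0) (ker (P n)) (solution_op m n).

Variables (R : realType) (ofR : R -> K).

Definition shadowable : Prop :=
  forall eps : R, 0 < eps -> exists delta : R, 0 < delta /\
    forall y : int -> X,
      (forall n : nat,
         `|y (n.+1)%:Z - delay_map n (segment y n)| <= ofR delta) ->
      exists x : int -> X, is_solution 0 x /\
        forall n : nat, `|segment x n - segment y n| <= ofR eps.

(* Boundedness of the projections need not be required separately: the bound on
   T(n, m) P_m with n = m reads ‖P_m‖ <= D. *)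
Definition exp_dichotomy : Prop :=
  exists (P : nat -> {linear phase X r -> phase X r}) (D lambda : R),
  [/\ 0 < D /\ 0 < lambda,
      forall n phi, P n (P n phi) = P n phi,
      forall m n : nat, (m <= n)%N ->
        (forall phi, P n (solution_op n m phi) = solution_op n m (P m phi)) /\
        set_bij (ker (P m)) (ker (P n)) (solution_op n m),
      forall m n : nat, (m <= n)%N ->
        opnorm_le (fun phi => solution_op n m (P m phi))
          (ofR (D * expR (- lambda * (n - m)%:R))) &
      forall m n : nat, (n <= m)%N ->
        opnorm_le (fun phi => solution_op_back P n m (phi - P m phi))
          (ofR (D * expR (- lambda * (m - n)%:R)))].

End DelayEquation.

(* Main.v *)
Require Import Defs.
From HB Require Import structures.
From mathcomp Require Import all_boot all_order all_algebra.
From mathcomp Require Import complex.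
From mathcomp Require Import zify ring lra finmap.
From mathcomp Require Import all_classical all_reals all_analysis.
Set Implicit Arguments.
Unset Strict Implicit.
Unset Printing Implicit Defensive.
Import Order.TTheory GRing.Theory Num.Theory.
Import numFieldNormedType.Exports.
Local Open Scope classical_set_scope.
Local Open Scope ring_scope.

(* Write T(n, m) for the solution operator.

   Dichotomy implies shadowing: if y has forcing errors z(k) and h(k) denotes the
   impulse of z(k), put s = sum_k T(0, k+1) Q_{k+1} h(k); the solution started at
   y_0 + s stays close to y, the difference being the Green function sum.

   Shadowing implies dichotomy: by scaling, every bounded forcing admits a bounded
   response, with a linear bound. Applied to a solution truncated to positive
   times, this says that every initial value is, modulo initial values of bounded
   solutions, in a ball whose size is controlled by T(r+1, 0). As T(r+1, 0) is
   compact, finitely many vectors span a complement of the space of bounded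
   solutions: approximate, rescale the remainder by 2 and iterate. A minimal such
   family gives a projection P_0, bounded along the whole evolution. All further
   estimates compare a solution x with the bounded response whose forcing is the
   defect of t |-> a(t) x(t), for an integer weight a with bounded increments:
   a step function yields the splitting at time m with uniform bounds, and
   trapezoidal weights yield decay like 1/|n - m|, hence halving over a fixed
   number of steps, hence exponential decay. *)

(* Real-valued norms over real or complex scalars *)
Existing Class real_or_complex.

Section RealNorm.
Context {R : realType} {K : numFieldType} {ofR : R -> K}.
Context {hK : real_or_complex ofR}.

Lemma ofRD : {morph ofR : a b / a + b}.
Proof. by case: hK => // a b; rewrite rmorphD. Qed.

Lemma ofRM : {morph ofR : a b / a * b}.
Proof. by case: hK => // a b; rewrite rmorphM. Qed.

Lemma ofR0 : ofR 0 = 0.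
Proof. by case: hK => //; rewrite rmorph0. Qed.

Lemma ofR1 : ofR 1 = 1.
Proof. by case: hK => //; rewrite rmorph1. Qed.

Lemma ler_ofR a b : (ofR a <= ofR b) = (a <= b).
Proof. by case: hK => //; rewrite lecR. Qed.

Lemma ofR_inj : injective ofR.
Proof. by move=> a b ab; apply/eqP; rewrite eq_le -!ler_ofR ab lexx. Qed.

Lemma ltr_ofR a b : (ofR a < ofR b) = (a < b).
Proof. by rewrite !lt_neqAle ler_ofR (inj_eq ofR_inj). Qed.

Lemma ofRN : {morph ofR : a / - a}.
Proof. by move=> a; apply/eqP; rewrite -addr_eq0 -ofRD addNr ofR0. Qed.

Lemma normr_ofR a : `|ofR a| = ofR `|a|.
Proof.
have [a0|a0] := leP 0 a; first by rewrite !ger0_norm// -ofR0 ler_ofR.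
by rewrite !ltr0_norm ?ofRN// -ofR0 ltr_ofR.
Qed.

Lemma ofR_int (a : int) : ofR a%:~R = a%:~R.
Proof.
have ofRn n : ofR n%:R = n%:R.
  by elim: n => [|n IH]; rewrite ?ofR0// !mulrS ofRD IH ofR1.
by case: a => n; rewrite ?NegzE ?mulrNz ?ofRN -?pmulrn ofRn.
Qed.

(** Being nonnegative in [R[i]] includes having zero imaginary part, so every norm is the image of a
    real number. *)
Lemma ofR_surj_ge0 (t : K) : 0 <= t -> exists a, ofR a = t.
Proof.
case: hK t => [t _|[a b]]; first by exists t.
by rewrite lecE /= => /andP[/eqP -> _]; exists a.
Qed.

(** Inverse of [ofR] on its range, with default value 0 elsewhere; it is only applied to norms. *)
Definition toR (t : K) : R := xget 0 [set a | ofR a = t].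

Lemma ofRK : cancel ofR toR.
Proof.
by move=> a; apply: ofR_inj; apply: (xgetPex 0 (P := [set b | ofR b = _])); exists a.
Qed.

Lemma toRK t : 0 <= t -> ofR (toR t) = t.
Proof. by move=> /ofR_surj_ge0[a <-]; rewrite ofRK. Qed.

Lemma toR_normr_ge0 (a : K) : 0 <= toR `|a|.
Proof. by rewrite -ler_ofR ofR0 toRK. Qed.

Lemma toR_normrM (a b : K) : toR `|a * b| = toR `|a| * toR `|b|.
Proof. by apply: ofR_inj; rewrite ofRM !toRK// normrM. Qed.

Lemma toR_normrB (a b : K) : toR `|a - b| <= toR `|a| + toR `|b|.
Proof. by rewrite -ler_ofR ofRD !toRK// ler_normB. Qed.

Lemma toR_normr_ofR a : toR `|ofR a| = `|a|.
Proof. by rewrite normr_ofR ofRK. Qed.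

Definition nrm {V : normedModType K} (v : V) : R := toR `|v|.

Section NormTheory.
Context {V : normedModType K}.
Implicit Types v w : V.

Lemma ofR_nrm v : ofR (nrm v) = `|v|.
Proof. exact: toRK. Qed.

Lemma nrm_le v a : (nrm v <= a) = (`|v| <= ofR a).
Proof. by rewrite -ofR_nrm ler_ofR. Qed.

Lemma nrm_ge0 v : 0 <= nrm v.
Proof. by rewrite -ler_ofR ofR0 ofR_nrm. Qed.

Lemma nrm0 : nrm (0 : V) = 0.
Proof. by apply: ofR_inj; rewrite ofR_nrm normr0 ofR0. Qed.

Lemma nrm_eq0 v : nrm v = 0 -> v = 0.
Proof. by move=> v0; apply/eqP; rewrite -normr_eq0 -ofR_nrm v0 ofR0. Qed.

Lemma nrmN v : nrm (- v) = nrm v.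
Proof. by rewrite /nrm normrN. Qed.

Lemma nrmBC v w : nrm (v - w) = nrm (w - v).
Proof. by rewrite /nrm distrC. Qed.

Lemma nrmD v w : nrm (v + w) <= nrm v + nrm w.
Proof. by rewrite nrm_le ofRD !ofR_nrm ler_normD. Qed.

Lemma nrmB v w : nrm (v - w) <= nrm v + nrm w.
Proof. by rewrite -(nrmN w) nrmD. Qed.

Lemma nrmZ k v : nrm (k *: v) = toR `|k| * nrm v.
Proof. by apply: ofR_inj; rewrite ofRM toRK ?ofR_nrm ?normrZ. Qed.

Lemma nrmZr a v : nrm (ofR a *: v) = `|a| * nrm v.
Proof. by apply: ofR_inj; rewrite ofRM !ofR_nrm normrZ normr_ofR. Qed.

Lemma nrm_int (a : int) v : nrm (a%:~R *: v) = `|a|%:~R * nrm v.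
Proof. by rewrite -ofR_int nrmZr -intr_norm. Qed.

Lemma nrm_sum I (s : seq I) (P : pred I) (F : I -> V) :
  nrm (\sum_(i <- s | P i) F i) <= \sum_(i <- s | P i) nrm (F i).
Proof.
elim/big_ind2 : _ => [|a v b w va wb|//]; first by rewrite nrm0.
by rewrite (le_trans (nrmD _ _))// lerD.
Qed.

Lemma nrm_sum_le (I : finType) (P : pred I) (F : I -> V) B : 0 <= B ->
  (forall i, P i -> nrm (F i) <= B) -> nrm (\sum_(i | P i) F i) <= #|I|%:R * B.
Proof.
move=> B0 FB; rewrite (le_trans (nrm_sum _ _ _))//.
rewrite (le_trans (ler_sum _ FB))// sumr_const -[B in B *+ _]mul1r -mulrnAl.
by rewrite ler_wpM2r// ler_nat max_card.
Qed.

End NormTheory.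

Lemma nrm_opnorm {V W : normedModType K} (f : V -> W) c :
  opnorm_le f (ofR c) <-> forall v, nrm (f v) <= c * nrm v.
Proof.
by split=> h v; [|move: (h v)]; rewrite nrm_le ofRM ofR_nrm.
Qed.


Section PhaseNormTheory.
Context {X : normedModType K} {r : nat}.
Implicit Types phi psi : phase X r.

Lemma nrm_phase_le phi a : 0 <= a -> (forall j, nrm (phi j) <= a) -> nrm phi <= a.
Proof.
move=> a0 h; rewrite nrm_le; apply/(phase_norm_leP phi) => [|j].
  by rewrite -ofR0 ler_ofR.
by rewrite -nrm_le.
Qed.

Lemma le_nrm_phase phi j : nrm (phi j) <= nrm phi.
Proof. by rewrite nrm_le ofR_nrm; exact: le_phase_norm. Qed.

End PhaseNormTheory.

(** * Geometric sequences and completeness *)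

Lemma expr_small (q e : R) : 0 <= q < 1 -> 0 < e -> exists n, q ^+ n <= e.
Proof.
move=> /andP[q0 q1] e0; have q1' : `|q| < 1 by rewrite ger0_norm.
have /cvgrPdist_le/(_ e e0)[n _ /(_ n (leqnn n))] := cvg_expr q1'.
by rewrite sub0r normrN ger0_norm ?exprn_ge0//; exists n.
Qed.

(** Used to pass to the limit in an estimate whose error term is geometric. *)
Lemma ge0_le_geometric (q a C : R) : 0 <= q < 1 -> 0 <= C ->
  (forall n, a <= C * q ^+ n) -> a <= 0.
Proof.
move=> q01 C0 h; rewrite leNgt; apply/negP => a0.
have C1 : 0 < C + 1 by lra.
have [n hn] := expr_small q01 (divr_gt0 a0 C1).
have := h n; apply/negP; rewrite -ltNge.
have : (C + 1) * q ^+ n <= a by rewrite mulrC -ler_pdivlMr.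
have [->|qn] := eqVneq (q ^+ n) 0; first by rewrite !mulr0.
have : 0 < q ^+ n by rewrite lt_def qn exprn_ge0//; case/andP: q01.
nra.
Qed.

Lemma geometric_dist (V : normedModType K) (u : nat -> V) C q : 0 <= q < 1 -> 0 <= C ->
  (forall n, nrm (u n.+1 - u n) <= C * q ^+ n) ->
  forall n m, (n <= m)%N -> nrm (u m - u n) <= C / (1 - q) * q ^+ n.
Proof.
move=> /andP[q0 q1] C0 hu n m /subnK <-; move: (m - n)%N => k {m}.
have q1' : 0 < 1 - q by lra.
(* The exact partial sum of the geometric series is kept on the right so that the induction
   closes. *)
suff : nrm (u (k + n)%N - u n) <= C / (1 - q) * (q ^+ n - q ^+ (k + n)).
  move=> /le_trans; apply; apply: ler_wpM2l; first by rewrite divr_ge0// ltW.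
  by rewrite lerBlDr lerDl exprn_ge0.
elim: k => [|k IH]; first by rewrite !subrr nrm0 mulr0.
have -> : u (k.+1 + n)%N - u n = (u (k + n)%N - u n) + (u (k + n).+1 - u (k + n)%N).
  by rewrite [RHS]addrC subrKA.
apply: (le_trans (nrmD _ _)).
have -> : C / (1 - q) * (q ^+ n - q ^+ (k.+1 + n)) =
  C / (1 - q) * (q ^+ n - q ^+ (k + n)) + C * q ^+ (k + n).
  by rewrite addSn exprS; field; rewrite lt0r_neq0.
by rewrite lerD// hu.
Qed.

Section Complete.
Context {X : completeNormedModType K}.

Lemma geometric_limit (u : nat -> X) C q : 0 <= q < 1 -> 0 <= C ->
  (forall n, nrm (u n.+1 - u n) <= C * q ^+ n) ->
  exists l, forall n, nrm (l - u n) <= C / (1 - q) * q ^+ n.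
Proof.
move=> q01 C0 hu; have hd := geometric_dist q01 C0 hu.
have q1 : 0 < 1 - q by case/andP: q01; lra.
have [q0 _] := andP q01.
have D0 : 0 <= C / (1 - q) by rewrite divr_ge0// ltW.
have /cauchy_cvgP cu : cauchy (u @ \oo).
  apply: cauchy_exP => e e0; have [d de] := ofR_surj_ge0 (ltW e0).
  have d0 : 0 < d by rewrite -ltr_ofR ofR0 de.
  have [n hn] : exists n, C / (1 - q) * q ^+ n < d.
    have [n hn] := expr_small q01 (divr_gt0 d0 (ltr_pwDr ltr01 D0)).
    exists n; rewrite ler_pdivlMr ?ltr_pwDr// in hn.
    have [->|qn] := eqVneq (q ^+ n) 0; first by rewrite mulr0.
    have : 0 < q ^+ n by rewrite lt_def qn exprn_ge0.
    nra.
  exists (u n); exists n => // m /= nm; rewrite -ball_normE /= -de distrC.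
  rewrite -ofR_nrm ltr_ofR; exact: le_lt_trans (hd _ _ nm) hn.
exists (lim (u @ \oo)) => n; rewrite nrm_le.
apply/ler_addgt0Pr => e e0.
have /cvgrPdist_le/(_ e e0)[m _ hm] := cu.
have -> : lim (u @ \oo) - u n =
  (u (maxn n m) - u n) + (lim (u @ \oo) - u (maxn n m)) by rewrite [RHS]addrC subrKA.
rewrite (le_trans (ler_normD _ _))// lerD ?hm//= ?leq_maxr//.
by rewrite -ofR_nrm ler_ofR hd// leq_maxl.
Qed.

(** Limits are taken coordinatewise; the maximum norm preserves the constant. *)
Lemma phase_geometric_limit r (u : nat -> phase X r) C q : 0 <= q < 1 -> 0 <= C ->
  (forall n, nrm (u n.+1 - u n) <= C * q ^+ n) ->
  exists l, forall n, nrm (l - u n) <= C / (1 - q) * q ^+ n.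
Proof.
move=> q01 C0 hu.
have q1 : 0 < 1 - q by case/andP: q01; lra.
have /choice[l hl] (j : 'I_r.+1) : exists l : X,
    forall n, nrm (l - u n j) <= C / (1 - q) * q ^+ n.
  apply: (geometric_limit q01 C0) => n; apply: le_trans (hu n).
  by have := le_nrm_phase (u n.+1 - u n) j; rewrite !ffunE.
exists [ffun j => l j] => n; apply: nrm_phase_le => [|j]; last by rewrite !ffunE.
by rewrite mulr_ge0 ?exprn_ge0 ?divr_ge0 ?(ltW q1)//; case/andP: q01.
Qed.

End Complete.

End RealNorm.

(** * Linear evolution operators and variation of constants *)

Section Evolution.
Context {K : numFieldType} {X : normedModType K} {r : nat}.
Context {A : 'I_r.+1 -> nat -> {linear X -> X}}.
Implicit Types (x y : int -> X) (phi psi : phase X r).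

Lemma segment_shift x n (j : 'I_r.+1) (jr : (j.+1 < r.+1)%N) :
  segment x n.+1 (Ordinal jr) = segment x n j.
Proof. by rewrite !ffunE; congr x; rewrite /=; lia. Qed.

Lemma segment_ord0 x n : segment (r := r) x n ord0 = x n%:Z.
Proof. by rewrite ffunE subr0. Qed.

Lemma phaseP phi psi : phi ord0 = psi ord0 ->
  (forall (j : 'I_r.+1) (jr : (j.+1 < r.+1)%N), phi (Ordinal jr) = psi (Ordinal jr)) ->
  phi = psi.
Proof.
move=> h0 hS; apply/ffunP => -[[|j] jr].
  by rewrite (_ : Ordinal jr = ord0)//; exact: val_inj.
exact: (hS (Ordinal (ltnW jr))).
Qed.

Lemma delay_map_linear n : linear (delay_map A n).
Proof.
move=> a phi psi; rewrite /delay_map scaler_sumr -big_split/=.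
by apply: eq_bigr => j _; rewrite !ffunE linearP.
Qed.

HB.instance Definition _ n := GRing.isLinear.Build K (phase X r) X *:%R
  (delay_map A n) (delay_map_linear n).

Lemma segment_linear n a x y :
  segment (a *: x + y) n = a *: segment x n + segment y n :> phase X r.
Proof. by apply/ffunP => j; rewrite !ffunE. Qed.

Lemma is_solutionW m k x : (m <= k)%N -> is_solution A m x -> is_solution A k x.
Proof. by move=> mk sx n kn; apply: sx; exact: leq_trans kn. Qed.

Lemma is_solution_linear m a x y :
  is_solution A m x -> is_solution A m y -> is_solution A m (a *: x + y).
Proof. by move=> sx sy n mn; rewrite segment_linear linearP/= -sx// -sy. Qed.

Lemma solution_opE m k n x : is_solution A m x -> (m <= k <= n)%N ->
  solution_op A n k (segment x k) = segment x n.
Proof.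
move=> sx /andP[mk kn]; have [sol solk] := solutionP A k (segment x k).
apply/ffunP => j; rewrite !ffunE.
apply: (solution_unique sol (is_solutionW mk sx) solk).
by have := ltn_ord j; lia.
Qed.

(** The solution operator extended by the identity when [n < m], which makes it linear for all
    indices without side conditions. *)
Definition evol (n m : nat) (phi : phase X r) : phase X r :=
  if (m <= n)%N then solution_op A n m phi else phi.

Lemma evol_linear n m : linear (evol n m).
Proof.
move=> a phi psi; rewrite /evol; case: leqP => // mn.
have [sphi phiE] := solutionP A m phi; have [spsi psiE] := solutionP A m psi.
have sD := is_solution_linear a sphi spsi.
rewrite -[in LHS]phiE -[in LHS]psiE -segment_linear (solution_opE sD) ?leqnn//.
by rewrite segment_linear.
Qed.

HB.instance Definition _ n m := GRing.isLinear.Build K (phase X r) (phase X r) *:%R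
  (evol n m) (evol_linear n m).

Lemma evolE m n phi : (m <= n)%N -> solution_op A n m phi = evol n m phi.
Proof. by rewrite /evol => ->. Qed.

Lemma evol_segment m k n x : is_solution A m x -> (m <= k <= n)%N ->
  evol n k (segment x k) = segment x n.
Proof.
by move=> sx /[dup] /andP[_ kn] mkn; rewrite -evolE// (solution_opE sx).
Qed.

Lemma evol_id n phi : evol n n phi = phi.
Proof.
have [sol solE] := solutionP A n phi.
by rewrite -[in LHS]solE (evol_segment sol) ?leqnn.
Qed.

Lemma evol_comp k m n phi : (k <= m <= n)%N -> evol n m (evol m k phi) = evol n k phi.
Proof.
move=> /andP[km mn]; have [sol solE] := solutionP A k phi.
rewrite -solE (evol_segment sol) ?leqnn// (evol_segment sol) ?km//.
by rewrite (evol_segment sol) ?leqnn ?(leq_trans km).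
Qed.

Lemma evolS_ord0 n phi : evol n.+1 n phi ord0 = delay_map A n phi.
Proof.
have [sol solE] := solutionP A n phi.
by rewrite -[in LHS]solE (evol_segment sol) ?leqnn ?leqnSn// segment_ord0 sol// solE.
Qed.

Lemma evolS_shift n phi (j : 'I_r.+1) (jr : (j.+1 < r.+1)%N) :
  evol n.+1 n phi (Ordinal jr) = phi j.
Proof.
have [sol solE] := solutionP A n phi.
by rewrite -[in LHS]solE (evol_segment sol) ?leqnn ?leqnSn// segment_shift solE.
Qed.

(** Compatible segments glue to one function: the newest entry gives each time [t >= 0], and the
    entry of index [|t|] in [s 0] gives each time [-r <= t < 0]. *)
Lemma segment_lift (s : nat -> phase X r) :
  (forall n (j : 'I_r.+1) (jr : (j.+1 < r.+1)%N), s n.+1 (Ordinal jr) = s n j) ->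
  exists x, forall n, segment x n = s n.
Proof.
move=> sS; pose x (t : int) := if 0 <= t then s `|t|%N ord0 else s 0%N (inord `|t|).
exists x; elim=> [|n IH].
  apply: phaseP => [|j jr]; rewrite ffunE /x ?subr0//=.
  by congr (s _ _); apply: val_inj; rewrite /= inordK; lia.
apply: phaseP => [|j jr]; last by rewrite segment_shift IH sS.
by rewrite segment_ord0.
Qed.

(** The forcing term of the scalar equation as a vector of the phase space: it enters only at the
    newest coordinate, and the other coordinates are merely shifted. *)
Definition impulse (v : X) : phase X r := [ffun j => if j == ord0 then v else 0].

Lemma impulse_ord0 v : impulse v ord0 = v.
Proof. by rewrite ffunE eqxx. Qed.

Lemma impulse_shift v (j : 'I_r.+1) (jr : (j.+1 < r.+1)%N) : impulse v (Ordinal jr) = 0.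
Proof. by rewrite ffunE. Qed.

Lemma forced_segment (z : nat -> X) y :
  (forall n, y n.+1%:Z = delay_map A n (segment y n) + z n) ->
  forall n, segment y n.+1 = evol n.+1 n (segment y n) + impulse (z n).
Proof.
move=> hy n; apply: phaseP => [|j jr]; rewrite [RHS]ffunE.
  by rewrite segment_ord0 evolS_ord0 hy impulse_ord0.
by rewrite segment_shift evolS_shift impulse_shift addr0.
Qed.

Lemma forced_exists (z : nat -> X) phi :
  exists y, segment y 0 = phi /\
    forall n, y n.+1%:Z = delay_map A n (segment y n) + z n.
Proof.
pose fix s n : phase X r :=
  if n is k.+1 then evol k.+1 k (s k) + impulse (z k) else phi.
have [|y hy] := @segment_lift s.
  by move=> n j jr; rewrite /= ffunE evolS_shift impulse_shift addr0.
exists y; split=> [|n]; first exact: hy.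
by rewrite -segment_ord0 !hy /= ffunE evolS_ord0 impulse_ord0.
Qed.

(** Each step transports the earlier impulses and adds a new one. The index is [k.+1] because [z k]
    first appears in the segment at time [k.+1]. *)
Lemma variation_of_constants (z : nat -> X) y :
  (forall n, y n.+1%:Z = delay_map A n (segment y n) + z n) ->
  forall n, segment y n =
    evol n 0 (segment y 0) + \sum_(k < n) evol n k.+1 (impulse (z k)).
Proof.
move=> hy; elim=> [|n IH]; first by rewrite big_ord0 addr0 evol_id.
rewrite (forced_segment hy) IH linearD/= evol_comp ?leqnSn// -addrA; congr +%R.
rewrite big_ord_recr /= evol_id linear_sum; congr +%R.
by apply: eq_bigr => k _ /=; rewrite evol_comp ?leqnSn ?ltn_ord.
Qed.

End Evolution.
Arguments evol {K X r} A n m phi.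
Arguments impulse {K X} r v.

(** * Growth bounds for the evolution *)

Section EvolutionBounds.
Context {R : realType} {K : numFieldType} {ofR : R -> K}.
Context {hK : real_or_complex ofR} {X : normedModType K} {r : nat}.
Context {A : 'I_r.+1 -> nat -> {linear X -> X}}.
Local Notation nrm := (nrm (ofR := ofR)).
Implicit Types (v : X) (phi psi : phase X r).

Lemma nrm_impulse v : nrm (impulse r v) <= nrm v.
Proof.
apply: nrm_phase_le => [|j]; first exact: nrm_ge0.
by rewrite ffunE; case: eqP; rewrite ?nrm0 ?nrm_ge0.
Qed.

Context {C : R} (C1 : 1 <= C)
  (AC : forall j n, opnorm_le (A j n) (ofR C)).

(** Bound for one step of the evolution: [r.+1] coefficients of norm at most [C]. Being at least 1,
    it also covers the shifted coordinates. *)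
Definition growth : R := r.+1%:R * C.

Lemma growth_ge1 : 1 <= growth.
Proof. by rewrite /growth -[leLHS]mul1r ler_pM// ler1n. Qed.

Lemma nrm_delay_map n phi : nrm (delay_map A n phi) <= growth * nrm phi.
Proof.
have C0 : 0 <= C := le_trans ler01 C1.
have B0 : 0 <= C * nrm phi by rewrite mulr_ge0 ?nrm_ge0.
rewrite (le_trans (nrm_sum_le B0 _))//= => [j _|]; last first.
  by rewrite card_ord mulrA.
have /nrm_opnorm := AC j n => /(_ (phi j)) /le_trans; apply.
by rewrite ler_wpM2l ?le_nrm_phase.
Qed.

Lemma nrm_evolS n phi : nrm (evol A n.+1 n phi) <= growth * nrm phi.
Proof.
have g1 := growth_ge1.
apply: nrm_phase_le => [|j]; first by rewrite mulr_ge0 ?nrm_ge0//; lra.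
case: j => -[|j] jr.
  by rewrite (_ : Ordinal jr = ord0) ?evolS_ord0 ?nrm_delay_map//; exact: val_inj.
rewrite (evolS_shift (j := Ordinal (ltnW jr)) n phi jr).
by rewrite (le_trans (le_nrm_phase _ _))// ler_peMl ?nrm_ge0.
Qed.

Lemma nrm_evol n m phi : nrm (evol A n m phi) <= growth ^+ (n - m) * nrm phi.
Proof.
have g1 := growth_ge1.
have [mn|nm] := leqP m n; last first.
  by rewrite /evol leqNgt nm/= (eqnP (ltnW nm)) mul1r.
rewrite -(subnK mn) addnK; move: (n - m)%N => k {n mn}.
elim: k => [|k IH]; first by rewrite evol_id mul1r.
rewrite addSn -(@evol_comp _ _ _ _ _ (k + m)%N) ?leq_addl ?leqnSn//.
rewrite (le_trans (nrm_evolS _ _))// exprS -mulrA ler_wpM2l//; lra.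
Qed.

End EvolutionBounds.
Arguments growth {R} r C.

(** * Exponential dichotomy implies shadowing *)

Section DichotomyShadowing.
Context {R : realType} {K : numFieldType} {ofR : R -> K}.
Context {hK : real_or_complex ofR} {X : completeNormedModType K} {r : nat}.
Context {A : 'I_r.+1 -> nat -> {linear X -> X}}.
Local Notation nrm := (nrm (ofR := ofR)).
Local Notation T := (evol A).

Lemma sum_geometric_le (q : R) n : 0 <= q < 1 ->
  \sum_(k < n) q ^+ (n - k.+1) <= (1 - q)^-1.
Proof.
move=> /andP[q0 q1]; have q1' : 0 < 1 - q by lra.
elim: n => [|n IH]; first by rewrite big_ord0 invr_ge0 ltW.
rewrite big_ord_recr/= subnn expr0.
have -> : \sum_(i < n) q ^+ (n.+1 - i.+1) = q * \sum_(i < n) q ^+ (n - i.+1).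
  by rewrite mulr_sumr; apply: eq_bigr => i _; rewrite -exprS subnSK.
have -> : (1 - q)^-1 = q * (1 - q)^-1 + 1 by field; rewrite lt0r_neq0.
by rewrite lerD2r ler_wpM2l.
Qed.

Lemma dichotomy_shadowable (C : R) : 1 <= C -> (forall j n, opnorm_le (A j n) (ofR C)) ->
  exp_dichotomy A ofR -> shadowable A ofR.
Proof.
move=> C1 AC [P [D [l [[D0 l0] PP TP TPle TQle]]]].
pose q := expR (- l); pose Q n phi := phi - P n phi.
have q01 : 0 <= q < 1 by rewrite expR_ge0/= expR_lt1 oppr_lt0.
have [q0 q1] := andP q01.
have q1' : 0 < 1 - q by lra.
have kerQ n phi : ker (P n) (Q n phi) by rewrite /ker/= linearB/= PP subrr.
have Tker n m phi : (m <= n)%N -> ker (P m) phi -> ker (P n) (T n m phi).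
  by move=> mn phi0; rewrite /ker/= -evolE// (TP _ _ mn).1 phi0 evolE// linear0.
have backK m n u : (m <= n)%N -> ker (P m) u -> solution_op_back A P m n (T n m u) = u.
  move=> mn u0; rewrite -evolE// /solution_op_back pinvKV//; last by rewrite inE.
  by have [_ []] := TP _ _ mn.
(* The unstable part of [phi] at time [n], pulled back to time 0. Moving it forward again gives the
   backward operator up to time [n] and the forward one afterwards. *)
pose b n phi := solution_op_back A P 0 n (Q n phi).
have bE n phi m : (m <= n)%N ->
    T m 0 (b n phi) = solution_op_back A P m n (Q n phi).
  move=> mn; have [_ [_ _ /(_ _ (kerQ n phi))[u u0 uE]]] := TP _ _ (leq0n n).
  rewrite evolE// in uE.
  by rewrite /b -uE backK// -(@evol_comp _ _ _ _ 0%N m n)// backK//; apply: Tker.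
have TbE n phi m : (n <= m)%N -> T m 0 (b n phi) = T m n (Q n phi).
  move=> nm; have [_ [_ _ /(_ _ (kerQ n phi))[u u0 uE]]] := TP _ _ (leq0n n).
  by rewrite evolE// in uE; rewrite /b -uE backK// evol_comp.
have ble m n phi : (m <= n)%N -> nrm (T m 0 (b n phi)) <= D * q ^+ (n - m) * nrm phi.
  move=> mn; rewrite bE// -expRM_natr.
  by have /nrm_opnorm /(_ phi) := TQle _ _ mn.
(* The stable and the unstable error are each at most [D * delta / (1 - q)], which this [delta]
   makes equal to [eps / 2]. *)
move=> eps eps0; pose delta := eps * (1 - q) / (2 * D); exists delta.
have delta0 : 0 < delta by rewrite divr_gt0 ?mulr_gt0.
have d0 := ltW delta0.
split=> // y hy; pose z n := y n.+1%:Z - delay_map A n (segment y n).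
have hz n : nrm (z n) <= delta by rewrite nrm_le hy.
have ghz n : nrm (impulse r (z n)) <= delta by rewrite (le_trans (nrm_impulse _)).
pose sg N := \sum_(k < N) b k.+1 (impulse r (z k)).
have sgS n N : nrm (T n 0 (sg (n + N).+1) - T n 0 (sg (n + N)%N)) <= D * delta * q ^+ N.
  have sgD : sg (n + N).+1 - sg (n + N)%N = b (n + N).+1 (impulse r (z (n + N)%N)).
    by rewrite /sg big_ord_recr/= [LHS]addrC addKr.
  rewrite -linearB sgD /=.
  rewrite (le_trans (ble _ _ _ _))//; first by rewrite -addnS leq_addr.
  rewrite -addnS addKn (mulrC _ (q ^+ N.+1)) (mulrC _ (q ^+ N)) -mulrA.
  apply: ler_pM; [exact: exprn_ge0|by rewrite mulr_ge0 ?nrm_ge0// ltW| |].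
    by rewrite exprS ler_piMl ?exprn_ge0// ltW.
  by rewrite ler_wpM2l// ltW.
have Dd0 : 0 <= D * delta by rewrite mulr_ge0// ltW.
have [N|s hs] := phase_geometric_limit (u := sg) q01 Dd0.
  by have := sgS 0%N N; rewrite add0n !evol_id.
have E0 : 0 <= D * delta / (1 - q) by rewrite divr_ge0// ltW.
have G0 n : 0 <= growth r C ^+ n.
  by rewrite exprn_ge0// (le_trans ler01)// growth_ge1.
(* Seen from time [n], the tail of the series is geometric with ratio [q]. The distance from [s] to
   a far partial sum is amplified by at most a fixed power of the growth constant, so it vanishes in
   the limit. *)
have tail n : nrm (T n 0 (s - sg n)) <= D * delta / (1 - q).
  rewrite -subr_le0.
  apply: (@ge0_le_geometric _ q _
    (growth r C ^+ n * (D * delta / (1 - q)))) => //.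
    by rewrite mulr_ge0 ?G0.
  move=> N; rewrite lerBlDr.
  have -> : s - sg n = (s - sg (n + N)%N) + (sg (n + N)%N - sg n) by rewrite subrKA.
  rewrite linearD/= (le_trans (nrmD _ _))// lerD//.
    rewrite (le_trans (nrm_evol C1 AC _ _ _))// subn0 -mulrA ler_wpM2l//.
    rewrite (le_trans (hs _))// ler_wpM2l//.
    by rewrite exprD ler_piMl ?exprn_ge0// exprn_ile1// ltW.
  have gd k : nrm (T n 0 (sg (n + k.+1)%N) - T n 0 (sg (n + k)%N)) <= D * delta * q ^+ k.
    by rewrite addnS sgS.
  have := geometric_dist (u := fun k => T n 0 (sg (n + k)%N)) q01 Dd0 gd (leq0n N).
  by rewrite expr0 mulr1 addn0 linearB => /(_ hK).
exists (solution A 0 (segment y 0 + s)).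
have [sol solE] := solutionP A 0 (segment y 0 + s).
split=> // n; rewrite -nrm_le -(evol_segment (k := 0%N) (n := n) sol)// solE nrmBC.
rewrite (@variation_of_constants _ _ _ A z y); last first.
  by move=> k; rewrite /z addrC subrK.
rewrite linearD/= opprD addrACA subrr add0r.
(* Each impulse splits into its two components; the unstable ones with [k < n] cancel against the
   partial sum [sg n]. *)
have -> : \sum_(k < n) T n k.+1 (impulse r (z k)) - T n 0 s =
    \sum_(k < n) T n k.+1 (P k.+1 (impulse r (z k))) - T n 0 (s - sg n).
  rewrite linearB opprB/= addrA; congr (_ - _).
  rewrite /sg linear_sum -big_split; apply: eq_bigr => k _ /=.
  by rewrite TbE ?ltn_ord// -linearD/= /Q addrC subrK.
rewrite (le_trans (nrmB _ _))//.
have -> : eps = D * delta / (1 - q) + D * delta / (1 - q).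
  by rewrite /delta; field; rewrite !lt0r_neq0.
rewrite lerD// (le_trans (nrm_sum _ _ _))//.
apply: (@le_trans _ _ (\sum_(k < n) D * delta * q ^+ (n - k.+1))).
  apply: ler_sum => k _; have kn := ltn_ord k.
  have /nrm_opnorm /(_ (impulse r (z k))) := TPle _ _ kn.
  rewrite evolE// expRM_natr => /le_trans; apply.
  by rewrite mulrAC ler_wpM2r ?exprn_ge0// ler_wpM2l// ltW.
by rewrite -mulr_sumr ler_wpM2l// sum_geometric_le.
Qed.

End DichotomyShadowing.

(** * Precompact maps *)

Section Precompact.
Context {R : realType} {K : numFieldType} {ofR : R -> K}.
Context {hK : real_or_complex ofR}.
Local Notation nrm := (nrm (ofR := ofR)).

(* Total boundedness of the images of balls, in terms of a partition of the
   domain into finitely many classes rather than of a cover of the image: this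
   form passes to finite families by taking products of the index types. *)
Definition precompact_map (V W : normedModType K) (f : V -> W) : Prop :=
  forall M e : R, 0 < e -> exists (p : finType) (k : V -> p), forall u v,
    nrm u <= M -> nrm v <= M -> k u = k v -> nrm (f u - f v) <= e.

Lemma compact_precompact (V W : normedModType K) (f : V -> W) :
  compact_operator f -> precompact_map f.
Proof.
move=> cf M e e0; pose B := [set v : V | nrm v <= M].
have e2 : 0 < ofR (e / 2) by rewrite -ofR0 ltr_ofR divr_gt0.
have /cf : bounded_set B.
  exists (ofR M); split=> [|a Ma v]; last first.
    by rewrite /B/= nrm_le => /le_trans; apply; exact: ltW.
  by rewrite realE -ofR0 !ler_ofR; case: (ltgtP 0 M).
rewrite compact_cover => /(_ W setT (fun w => ball w (ofR (e / 2)))).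
case=> [w _|w _|D _ cov]; first exact: ball_open.
  by exists w => //; exact: ballxx.
(* The class of [v] is a centre of the finite cover near [f v]; [None] serves the vectors outside
   the ball. *)
have /choice[k hk] (v : V) : exists i : option D,
    nrm v <= M -> if i is Some w then nrm (val w - f v) <= e / 2 else false.
  have [vM|/negP vM] := boolP (nrm v <= M); last by exists None.
  have [|w wD] := cov (f v); first by apply: subset_closure; exists v.
  rewrite -ball_normE/= => wv; exists (Some (FSetSub wD)) => _ /=.
  by rewrite nrm_le ltW.
exists (option D), k => u v uM vM kuv.
move: (hk u uM) (hk v vM); rewrite kuv; case: (k v) => // w wu wv.
rewrite -(subrKA (val w)); rewrite (le_trans (nrmD _ _))// [leRHS]splitr.
by rewrite lerD// nrmBC.
Qed.

Lemma precompact_family (I : finType) (V : normedModType K)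
  (W : I -> normedModType K) (F : forall i, V -> W i) :
  (forall i, precompact_map (F i)) ->
  forall M e : R, 0 < e -> exists (p : finType) (k : V -> p), forall u v,
    nrm u <= M -> nrm v <= M -> k u = k v -> forall i, nrm (F i u - F i v) <= e.
Proof.
move=> pF M e e0.
suff [p [k hk]] : exists (p : finType) (k : V -> p), forall u v,
    nrm u <= M -> nrm v <= M -> k u = k v ->
    forall i, i \in enum I -> nrm (F i u - F i v) <= e.
  by exists p, k => u v uM vM kuv i; apply: hk => //; rewrite mem_enum.
elim: (enum I) => [|i s [p [k hk]]]; first by exists unit, (fun=> tt).
have [p' [k' hk']] := pF i M e e0.
exists (p * p')%type, (fun v => (k v, k' v)) => u v uM vM [kuv kuv'] j.
by rewrite inE => /orP[/eqP ->|js]; [exact: hk'|exact: hk].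
Qed.

Lemma precompact_comp (V V' W : normedModType K) (f : V -> W) (g : V' -> V) c :
  0 <= c -> (forall v, nrm (g v) <= c * nrm v) ->
  precompact_map f -> precompact_map (f \o g).
Proof.
move=> c0 hg pf M e e0; have [p [k hk]] := pf (c * M) e e0.
exists p, (k \o g) => u v uM vM kuv.
by apply: hk => //; rewrite (le_trans (hg _))// ler_wpM2l.
Qed.

Lemma precompact_sum (I : finType) (V W : normedModType K) (F : I -> V -> W) :
  (forall i, precompact_map (F i)) -> precompact_map (fun v => \sum_i F i v).
Proof.
move=> pF M e e0.
have e0' : 0 < e / (#|I|%:R + 1) by rewrite divr_gt0// ltr_wpDl.
have [p [k hk]] := precompact_family pF M e0'.
exists p, k => u v uM vM kuv; rewrite -sumrB.
rewrite (le_trans (nrm_sum_le (ltW e0') _))// => [i _|]; first exact: hk.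
rewrite mulrCA ler_piMr ?(ltW e0)// ler_pdivrMr ?ltr_wpDl// mul1r.
by rewrite lerDl.
Qed.

Lemma precompact_phase (V X : normedModType K) r (f : V -> phase X r) :
  (forall j, precompact_map (fun v => f v j)) -> precompact_map f.
Proof.
move=> pf M e e0; have [p [k hk]] := precompact_family pf M e0.
exists p, k => u v uM vM kuv; apply: nrm_phase_le => [|j]; first exact: ltW.
by have := hk u v uM vM kuv j; rewrite !ffunE.
Qed.

(** One representative is chosen in each class that meets the ball, and 0 in the others. *)
Lemma precompact_net (V W : normedModType K) (f : V -> W) (M e : R) :
  precompact_map f -> 0 <= M -> 0 < e ->
  exists (p : finType) (u : p -> V), (forall i, nrm (u i) <= M) /\
    forall v, nrm v <= M -> exists i, nrm (f v - f (u i)) <= e.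
Proof.
move=> pf M0 e0; have [p [k hk]] := pf M e e0.
have /choice[u hu] (i : p) : exists u : V, nrm u <= M /\
    forall v, nrm v <= M -> k v = i -> k u = i.
  have [[v [vM vi]]|nv] := pselect (exists v, nrm v <= M /\ k v = i).
    by exists v.
  by exists 0; rewrite nrm0; split=> // v vM vi; case: nv; exists v.
exists p, u; split=> [i|v vM]; first by have [] := hu i.
by exists (k v); have [uM ku] := hu (k v); apply: hk => //; rewrite (ku v).
Qed.

End Precompact.
Arguments precompact_map {R K} ofR {V W} f.

(** * Compactness of the evolution and bounded responses *)

Section Perron.
Context {R : realType} {K : numFieldType} {ofR : R -> K}.
Context {hK : real_or_complex ofR} {X : normedModType K} {r : nat}.
Context {A : 'I_r.+1 -> nat -> {linear X -> X}}.
Local Notation nrm := (nrm (ofR := ofR)).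
Local Notation T := (evol A).

Lemma evol0_coord n phi (j : 'I_r.+1) : (j < n)%N ->
  T n 0 phi j = delay_map A (n - j.+1) (T (n - j.+1) 0 phi).
Proof.
move=> jn; have [sol solE] := solutionP A 0 phi.
rewrite -[in LHS]solE (evol_segment sol) ?leqnn// ffunE.
rewrite -[in RHS]solE (evol_segment sol) ?leqnn// -sol// subnSK//.
by congr solution; lia.
Qed.

(** After [r.+1] steps no entry of the initial value survives in the segment: every coordinate has
    been produced by the equation, as a sum of compact operators applied to bounded maps. *)
Lemma evol_precompact (C : R) : 1 <= C -> (forall j n, opnorm_le (A j n) (ofR C)) ->
  (forall j n, compact_operator (A j n)) -> precompact_map ofR (T r.+1 0).
Proof.
move=> C1 AC cA; apply: precompact_phase => j; pose m := (r.+1 - j.+1)%N.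
have -> : (fun phi => T r.+1 0 phi j) =
    (fun phi => \sum_i (A i m \o (fun phi => T m 0 phi i)) phi).
  by apply/funext => phi; rewrite evol0_coord//.
apply: precompact_sum => i.
have G0 : 0 <= growth r C ^+ m.
  by rewrite exprn_ge0// (le_trans ler01)// growth_ge1.
apply: (precompact_comp (f := A i m) (g := fun phi => T m 0 phi i) G0).
  move=> phi; rewrite (le_trans (le_nrm_phase _ _))//.
  by rewrite (le_trans (nrm_evol C1 AC _ _ _))// subn0.
exact: compact_precompact.
Qed.

Definition forced (z : nat -> X) (w : int -> X) : Prop :=
  forall n : nat, w n.+1%:Z = delay_map A n (segment w n) + z n.

Lemma forced_diff z w w' : forced z w -> forced z w' ->
  forall n, segment w n - segment w' n = T n 0 (segment w 0 - segment w' 0).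
Proof.
move=> hw hw' n; rewrite (variation_of_constants hw) (variation_of_constants hw').
by rewrite opprD addrACA subrr addr0 linearB.
Qed.

(** Forcing scaled down to size [d] yields a pseudo-solution [y]; a solution [x] shadows it within
    1, and [y - x] scaled back is the bounded response. *)
Lemma shadowable_perron : shadowable A ofR ->
  exists C1 : R, 0 <= C1 /\ forall z B, 0 <= B -> (forall n, nrm (z n) <= B) ->
    exists w, forced z w /\ forall n, nrm (segment (r := r) w n) <= C1 * B.
Proof.
move=> /(_ 1 ltr01)[d [d0 sh]]; exists d^-1; split=> [|z B B0 hz].
  by rewrite invr_ge0 ltW.
(* The scaling divides by [B]; when [B = 0] the zero response works. *)
have [B00|B00] := eqVneq B 0.
  have z0 n : z n = 0.
    by apply: (@nrm_eq0 _ _ ofR); apply/eqP; rewrite eq_le nrm_ge0 -{1}B00 hz.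
  have s0 n : segment (0 : int -> X) n = 0 :> phase X r.
    by apply/ffunP => j; rewrite !ffunE.
  exists 0; split=> n; rewrite s0; first by rewrite z0 linear0 addr0.
  by rewrite nrm0 mulr_ge0// invr_ge0 ltW.
have {}B0 : 0 < B by rewrite lt_def B00.
pose a := ofR (B / d); have a0 : a != 0.
  by rewrite /a -ofR0 (inj_eq ofR_inj) mulf_neq0 ?invr_eq0 ?gt_eqF.
have [y [_ hy]] := forced_exists (A := A) (fun n => a^-1 *: z n) 0.
have [n|x [sx hx]] := sh y.
  rewrite -nrm_le hy addrC addKr.
  rewrite -(@ler_pM2l _ (B / d)) ?divr_gt0// divfK ?gt_eqF//.
  rewrite -(gtr0_norm (divr_gt0 B0 d0)) -nrmZr scalerA.
  by rewrite divff// scale1r.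
exists (a *: (y - x)).
have sE n : segment (a *: (y - x)) n = a *: (segment y n - segment x n) :> phase X r.
  by apply/ffunP => j; rewrite !ffunE.
split=> n; rewrite sE.
  have -> : delay_map A n (a *: (segment y n - segment x n)) =
      a *: (delay_map A n (segment y n) - x n.+1%:Z).
    by rewrite linearZ linearB (sx n).
  rewrite [LHS](_ : _ = a *: (y n.+1%:Z - x n.+1%:Z))// hy addrAC scalerDr.
  by rewrite scalerA divff// scale1r.
rewrite nrmZr ger0_norm ?divr_ge0 ?(ltW B0) ?(ltW d0)// [d^-1 * B]mulrC.
rewrite ler_piMr ?divr_ge0 ?(ltW B0) ?(ltW d0)// nrmBC nrm_le; exact: hx.
Qed.

End Perron.
Arguments forced {K X r} A z w.

(** * A bounded projection onto the initial values of bounded solutions *)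

Section StableProjection.
Context {R : realType} {K : numFieldType} {ofR : R -> K}.
Context {hK : real_or_complex ofR} {X : normedModType K} {r : nat}.
Context {A : 'I_r.+1 -> nat -> {linear X -> X}}.
Local Notation nrm := (nrm (ofR := ofR)).
Local Notation toR := (toR (ofR := ofR)).
Local Notation T := (evol A).

Definition perron (c : R) : Prop := 0 <= c /\
  forall z B, 0 <= B -> (forall n, nrm (z n) <= B) ->
    exists w, forced A z w /\ forall n, nrm (segment (r := r) w n) <= c * B.

Definition bounded_orbit m (phi : phase X r) : Prop :=
  exists M, forall n, (m <= n)%N -> nrm (T n m phi) <= M.

Lemma bounded_orbit_linear m a phi psi : bounded_orbit m phi -> bounded_orbit m psi ->
  bounded_orbit m (a *: phi + psi).
Proof.
move=> [M hM] [M' hM']; exists (toR `|a| * M + M') => n mn.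
rewrite linearP/= (le_trans (nrmD _ _))// lerD ?hM'// nrmZ.
by rewrite ler_wpM2l ?hM// toR_normr_ge0.
Qed.

Lemma bounded_orbit0 m : bounded_orbit m 0.
Proof. by exists 0 => n _; rewrite linear0 nrm0. Qed.

Lemma bounded_orbitB m phi psi : bounded_orbit m phi -> bounded_orbit m psi ->
  bounded_orbit m (phi - psi).
Proof.
by move=> h h'; have := bounded_orbit_linear (-1) h' h; rewrite scaleN1r addrC.
Qed.

Context {C : R} (C1 : 1 <= C) (AC : forall j n, opnorm_le (A j n) (ofR C)).
Context (A_compact : forall j n, compact_operator (A j n)).
Context {c : R} (cP : perron c).
Local Notation g := (growth r C).

Lemma growth_pow_ge1 n : 1 <= g ^+ n.
Proof. by rewrite exprn_ege1// growth_ge1. Qed.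

Lemma growth_pow_ge0 n : 0 <= g ^+ n.
Proof. exact: le_trans ler01 (growth_pow_ge1 n). Qed.

(** The solution is cut off to 0 at times [t <= 0]. The forcing this creates lives at times
    [n <= r], where it involves only the entries of [T r.+1 0 phi], all of norm at most 1. With [w]
    the bounded response, [phi + seg w 0] has orbit [seg w n] for [n > r], hence [v = - seg w 0]. *)
Lemma bounded_orbit_modulo_ball : exists M : R, 0 <= M /\
  forall phi, nrm (T r.+1 0 phi) <= 1 -> exists v, nrm v <= M /\
    forall n, (r < n)%N -> nrm (T n 0 (phi - v)) <= M.
Proof.
have [c0 cp] := cP; have g1 := growth_ge1 (r := r) C1.
have g2 : 0 <= 1 + g by lra.
exists (c * (1 + g)); split=> [|phi phi1]; first exact: mulr_ge0.
have [sol solE] := solutionP A 0 phi; move: sol solE; set x := solution A 0 phi.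
move=> sol solE; pose y (t : int) := if 0 < t then x t else 0.
pose z n := y n.+1%:Z - delay_map A n (segment y n).
have yz : forced A z y by move=> n; rewrite /z addrC subrK.
have yx n : (r < n)%N -> segment y n = segment x n :> phase X r.
  move=> rn; apply/ffunP => j; rewrite !ffunE /y.
  by have -> : 0 < n%:Z - j%:Z by have := ltn_ord j; lia.
have y1 (t : int) : t <= r.+1%:Z -> nrm (y t) <= 1.
  move=> tr; rewrite /y; case: ifPn => [t0|_]; last by rewrite nrm0.
  have jr : (r.+1 - `|t| < r.+1)%N by lia.
  have -> : x t = T r.+1 0 phi (Ordinal jr).
    by rewrite -solE (evol_segment sol)// ffunE /=; congr x; lia.
  exact: le_trans (le_nrm_phase _ _) _.
have [n|w [wz hw]] := cp z (1 + g) g2.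
  have [rn|nr] := ltnP r n.
    rewrite /z yx// -sol// /y.
    by rewrite (_ : 0 < n.+1%:Z)// subrr nrm0.
  rewrite (le_trans (nrmB _ _))// lerD//; first by apply: y1; lia.
  rewrite (le_trans (nrm_delay_map C1 AC _ _))// ler_piMr ?(le_trans ler01)//.
  apply: nrm_phase_le => // j; rewrite ffunE; apply: y1; lia.
have y0 : segment y 0 = 0 :> phase X r.
  by apply/ffunP => j; rewrite !ffunE /y; case: ifPn => // ?; lia.
exists (- segment w 0); split=> [|n rn]; first by rewrite nrmN.
have := forced_diff wz yz n; rewrite y0 subr0 yx// opprK linearD/=.
move=> <-; rewrite -solE (evol_segment sol)// addrC subrK; exact: hw.
Qed.

(** Approximating [v] by a net element [u k] leaves a remainder whose image under [T r.+1 0] has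
    norm at most 1/2. Doubled, it is again admissible, so the step repeats; weights halve each time,
    and the geometric sums give the bounds 2 and [2 * M]. *)
Lemma bounded_orbit_modulo_unit : exists (p : finType) (u : p -> phase X r) (M : R),
  [/\ 0 <= M, forall k, nrm (u k) <= M &
  forall phi, nrm (T r.+1 0 phi) <= 1 -> exists a : p -> R,
    (forall k, `|a k| <= 2) /\
    forall n, (r < n)%N -> nrm (T n 0 (phi - \sum_k ofR (a k) *: u k)) <= 2 * M].
Proof.
have [M [M0 hM]] := bounded_orbit_modulo_ball.
pose h : R := 1 / 2; have h0 : 0 < h by rewrite /h; lra.
have h01 : 0 <= h < 1 by rewrite /h; lra.
have [p [u [uM hu]]] := precompact_net (evol_precompact C1 AC A_compact) M0 h0.
exists p, u, M; split=> // phi phi1.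
(* One approximation step: the index of the chosen net element and the doubled remainder. *)
have /choice[F hF] (psi : phase X r) : exists kpsi : p * phase X r,
    nrm (T r.+1 0 psi) <= 1 -> nrm (T r.+1 0 kpsi.2) <= 1 /\
    forall n, (r < n)%N -> nrm (T n 0 (psi - u kpsi.1 - ofR h *: kpsi.2)) <= M.
  have [psi1|/negP psi1] := boolP (nrm (T r.+1 0 psi) <= 1); last first.
    have [|k _] := hu 0; first by rewrite nrm0.
    by exists (k, 0).
  have [v [vM hv]] := hM psi psi1; have [k hk] := hu v vM.
  exists (k, ofR 2 *: (v - u k)) => _ /=; split=> [|n rn].
    rewrite linearZ/= linearB/= nrmZr ger0_norm//.
    by rewrite -ler_pdivlMl// mulrC.
  rewrite scalerA -ofRM /h mul1r mulVf// ofR1 scale1r opprB addrA subrK.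
  exact: hv.
pose ph n := iter n (fun psi => (F psi).2) phi; pose k n := (F (ph n)).1.
(* The coefficient of [u i] collects the weights of those steps that selected [i]. *)
pose a n (i : p) := \sum_(j < n) h ^+ j * (k j == i)%:R.
have aS n i : a n.+1 i = a n i + h ^+ n * (k n == i)%:R by rewrite /a big_ord_recr.
have ph1 n : nrm (T r.+1 0 (ph n)) <= 1.
  by elim: n => //= n IH; have [] := hF _ IH.
(* What the first [n] steps have discarded: a sum of vectors with bounded orbits, of total size at
   most [2 * M * (1 - h ^+ n)]. *)
pose sg n := phi - \sum_i ofR (a n i) *: u i - ofR (h ^+ n) *: ph n.
have sgS n : sg n.+1 = sg n + ofR (h ^+ n) *: (ph n - u (k n) - ofR h *: ph n.+1).
  have SE : \sum_i ofR (a n.+1 i) *: u i =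
      \sum_i ofR (a n i) *: u i + ofR (h ^+ n) *: u (k n).
    rewrite (bigD1 (k n))//= [in RHS](bigD1 (k n))//= addrAC -scalerDl aS eqxx.
    rewrite mulr1 ofRD; congr +%R; apply: eq_bigr => i /negPf ik.
    by rewrite aS eq_sym ik mulr0 addr0.
  rewrite /sg SE !scalerBr scalerA -ofRM -exprSr; set P := \sum_i _.
  set B := _ *: u _; set Q := _ *: ph n; set Q' := _ *: ph n.+1.
  by rewrite opprD !addrA subrK.
have sgM n m : (r < m)%N -> nrm (T m 0 (sg n)) <= 2 * M * (1 - h ^+ n).
  move=> rm; elim: n => [|n IH].
    rewrite /sg (_ : \sum_i _ = 0) ?subr0; last first.
      by apply: big1 => i _; rewrite /a big_ord0 ofR0 scale0r.
    by rewrite expr0 ofR1 scale1r subrr linear0 nrm0 subrr mulr0.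
  rewrite sgS linearD/= (le_trans (nrmD _ _))//.
  have -> : 2 * M * (1 - h ^+ n.+1) = 2 * M * (1 - h ^+ n) + h ^+ n * M.
    by rewrite exprS /h; field.
  rewrite lerD// linearZ/= nrmZr ger0_norm ?exprn_ge0 ?(ltW h0)//.
  rewrite ler_wpM2l ?exprn_ge0 ?(ltW h0)//.
  by have [_ ] := hF _ (ph1 n); apply.
have /choice[l hl] (i : p) : exists l : R,
    forall n, `|l - a n i| <= 2 * h ^+ n.
  have [n|l hl] := @geometric_limit R R id (Real_scalars R) R^o
      (fun n => a n i) 1 h h01 ler01.
    rewrite (@nrm_le R R id (Real_scalars R)) aS addrC addKr mul1r.
    rewrite ger0_norm ?mulr_ge0 ?exprn_ge0 ?(ltW h0)//.
    by rewrite ler_piMr ?exprn_ge0 ?(ltW h0)//; case: eqP.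
  have <- : 1 / (1 - h) = 2 by rewrite /h; field.
  by exists l => n; have := hl n; rewrite (@nrm_le R R id (Real_scalars R)).
exists l; split=> [i|m rm].
  have := hl i 0%N; by rewrite /a big_ord0 subr0 expr0 mulr1.
(* At a fixed time [m], replacing [sg n] by its limit costs a multiple of [h ^+ n]: one part from
   the remainder [ph n], one from the coefficients. *)
rewrite -subr_le0.
apply: (@ge0_le_geometric _ h _ (g ^+ (m - r.+1) + 2 * \sum_i nrm (T m 0 (u i)))) => //.
  by rewrite addr_ge0 ?growth_pow_ge0 ?mulr_ge0 ?sumr_ge0// => i _; exact: nrm_ge0.
move=> n; rewrite lerBlDr [leRHS]addrC.
have -> : phi - \sum_i ofR (l i) *: u i =
    sg n + (ofR (h ^+ n) *: ph n - \sum_i ofR (l i - a n i) *: u i).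
  rewrite /sg addrA subrK -addrA -opprD -big_split/=; congr (_ - _).
  by apply: eq_bigr => i _; rewrite -scalerDl -ofRD addrC subrK.
rewrite linearD/= (le_trans (nrmD _ _))// lerD//.
  rewrite (le_trans (sgM _ _ rm))// ler_piMr ?mulr_ge0//.
  by rewrite lerBlDr lerDl exprn_ge0 ?(ltW h0).
rewrite linearB/= (le_trans (nrmB _ _))// mulrDl lerD//.
  rewrite linearZ/= nrmZr ger0_norm ?exprn_ge0 ?(ltW h0)// mulrC.
  rewrite ler_wpM2r ?exprn_ge0 ?(ltW h0)// -(@evol_comp _ _ _ _ 0%N r.+1)//.
  by rewrite (le_trans (nrm_evol C1 AC _ _ _))// ler_piMr ?growth_pow_ge0.
rewrite linear_sum (le_trans (nrm_sum _ _ _))// mulrAC mulr_sumr.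
by apply: ler_sum => i _; rewrite linearZ/= nrmZr ler_wpM2r ?nrm_ge0.
Qed.

(** The vectors [u k], [k] in [D], span the phase space modulo bounded solutions, with linear
    control. The bound on the coefficients keeps this control when one vector is eliminated. *)
Definition complement_family (p : finType) (u : p -> phase X r) (D : {set p}) : Prop :=
  exists M : R, 0 <= M /\ forall phi, exists a : p -> K,
    (forall k, toR `|a k| <= M * nrm phi) /\
    forall n, nrm (T n 0 (phi - \sum_(k in D) a k *: u k)) <= M * nrm phi.

Lemma complement_family_exists :
  exists (p : finType) (u : p -> phase X r), complement_family u [set: p]%SET.
Proof.
have [p [u [M [M0 uM hu]]]] := bounded_orbit_modulo_unit; exists p, u.
pose G := g ^+ r.+1; have G1 : 1 <= G := growth_pow_ge1 _.
have G0 : 0 <= G := growth_pow_ge0 _.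
have N0 : 0 <= 1 + #|p|%:R * (2 * G * M) by rewrite addr_ge0// !mulr_ge0.
exists (2 * G + (2 * M * G + G * (1 + #|p|%:R * (2 * G * M)))); split.
  by rewrite !addr_ge0 ?mulr_ge0.
move=> phi; have [phi0|phi0] := eqVneq (nrm phi) 0.
  rewrite (nrm_eq0 phi0) nrm0 mulr0; exists (fun=> 0); split=> [k|n].
    by rewrite normr0 -ofR0 ofRK.
  by rewrite big1 ?subr0 ?linear0 ?nrm0// => k _; rewrite scale0r.
have q0 : 0 < G * nrm phi.
  by apply: mulr_gt0; [exact: lt_le_trans ltr01 G1|rewrite lt_def phi0 nrm_ge0].
(* Dividing by [q] brings the image under [T r.+1 0] into the unit ball. The times [n <= r] are left
   to the growth bound. *)
pose q := ofR (G * nrm phi).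
have q00 : q != 0 by rewrite /q -ofR0 (inj_eq ofR_inj) gt_eqF.
have [|a [a2 ha]] := hu (q^-1 *: phi).
  rewrite linearZ/= -(ler_pM2l q0) mulr1 -{1}(gtr0_norm q0) -nrmZr scalerA divff//.
  by rewrite scale1r (le_trans (nrm_evol C1 AC _ _ _))// subn0.
have ale k : toR `|q * ofR (a k)| <= 2 * G * nrm phi.
  rewrite toR_normrM !toR_normr_ofR (gtr0_norm q0) mulrC -mulrA.
  by rewrite ler_wpM2r// ltW.
exists (fun k => q * ofR (a k)); split=> [k|n].
  rewrite (le_trans (ale k))// ler_wpM2r ?nrm_ge0// lerDl.
  by rewrite addr_ge0 ?mulr_ge0.
rewrite (eq_bigl xpredT) => [|k]; last by rewrite inE.
have [rn|nr] := ltnP r n.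
  have -> : phi - \sum_k (q * ofR (a k)) *: u k =
      q *: (q^-1 *: phi - \sum_k ofR (a k) *: u k).
    rewrite scalerBr scalerA divff// scale1r scaler_sumr; congr (_ - _).
    by apply: eq_bigr => k _; rewrite scalerA.
  rewrite linearZ/= nrmZr (gtr0_norm q0).
  rewrite (le_trans (ler_wpM2l (ltW q0) (ha n rn)))//.
  have -> : G * nrm phi * (2 * M) = 2 * M * G * nrm phi by ring.
  rewrite ler_wpM2r ?nrm_ge0// addrCA.
  by rewrite lerDl addr_ge0 ?mulr_ge0.
rewrite (le_trans (nrm_evol C1 AC _ _ _))// subn0.
apply: (@le_trans _ _ (G * ((1 + #|p|%:R * (2 * G * M)) * nrm phi))); last first.
  by rewrite mulrA ler_wpM2r ?nrm_ge0// addrA lerDr !addr_ge0 ?mulr_ge0.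
apply: ler_pM; rewrite ?growth_pow_ge0 ?nrm_ge0//.
  by rewrite ler_weXn2l ?growth_ge1// ltnW.
rewrite (le_trans (nrmB _ _))// mulrDl mul1r lerD2l.
have B0 : 0 <= 2 * G * nrm phi * M by rewrite !mulr_ge0 ?nrm_ge0.
rewrite (le_trans (nrm_sum_le B0 _))// => [k _|]; last by rewrite -!mulrA [M * _]mulrC.
by rewrite nrmZ ler_pM ?toR_normr_ge0 ?nrm_ge0.
Qed.

(** A bounded combination with [a j] nonzero would express [u j] through the other vectors modulo a
    bounded solution, so [j] could be dropped from [D]. *)
Lemma minimal_complement_free (p : finType) (u : p -> phase X r) (D : {set p}) :
  complement_family u D -> (forall j, j \in D -> ~ complement_family u (D :\ j)) ->
  forall a : p -> K, bounded_orbit 0 (\sum_(k in D) a k *: u k) ->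
  forall j, j \in D -> a j = 0.
Proof.
move=> [M [M0 hD]] minD a [B hB] j jD; apply/eqP/negPn/negP => aj; apply: (minD j jD).
have B0 : 0 <= B by apply: le_trans (hB 0%N isT); exact: nrm_ge0.
pose N i := toR `|a i / a j|.
have N0 i : 0 <= N i by exact: toR_normr_ge0.
pose b := toR `|(a j)^-1|; have b0 : 0 <= b by exact: toR_normr_ge0.
have sN0 : 0 <= \sum_i N i by apply: sumr_ge0.
exists (M + M * (\sum_i N i) + M * b * B); split; first by rewrite !addr_ge0 ?mulr_ge0.
move=> phi.
have [d [dM hd]] := hD phi.
exists (fun k => d k - d j * (a k / a j)); split=> [k|n].
  rewrite (le_trans (toR_normrB _ _))// !mulrDl -addrA lerD// toR_normrM.
  rewrite -[leLHS]addr0 lerD ?mulr_ge0 ?nrm_ge0// mulrAC.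
  apply: ler_pM; rewrite ?toR_normr_ge0//.
  by rewrite (bigD1 k)//= lerDl sumr_ge0.
have -> : \sum_(k in D :\ j) (d k - d j * (a k / a j)) *: u k =
    \sum_(k in D) d k *: u k - (d j / a j) *: \sum_(k in D) a k *: u k.
  rewrite scaler_sumr -sumrB [RHS](big_setD1 j)//= scalerA divfK// subrr add0r.
  by apply: eq_bigr => k _; rewrite scalerA scalerBl; congr (_ - _ *: _);
    rewrite mulrAC mulrA.
rewrite opprB addrCA addrC linearD/= (le_trans (nrmD _ _))// -addrA mulrDl lerD//.
rewrite linearZ/= nrmZ mulrDl -[leLHS]add0r lerD ?mulr_ge0 ?nrm_ge0//.
rewrite toR_normrM [leRHS]mulrAC; apply: ler_pM; rewrite ?mulr_ge0 ?toR_normr_ge0 ?nrm_ge0//.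
  by rewrite [leRHS]mulrAC ler_wpM2r.
exact: hB.
Qed.

(** For a minimal family the coefficients of [phi] are determined up to zero combinations, which
    makes the remainder a linear function of [phi]. *)
Lemma stable_projection_exists : exists (P0 : {linear phase X r -> phase X r}) (M : R),
  [/\ 0 <= M, forall phi n, nrm (T n 0 (P0 phi)) <= M * nrm phi &
      forall phi, bounded_orbit 0 phi -> P0 phi = phi].
Proof.
have [p [u uT]] := complement_family_exists.
have [|D /minsetP[/asboolP uD minD]] :=
  @ex_minset _ (fun D : {set p} => `[< complement_family u D >]).
  by exists [set: p]%SET; exact/asboolP.
have free := minimal_complement_free uD.
have {}free : forall a : p -> K, bounded_orbit 0 (\sum_(k in D) a k *: u k) ->
    forall j, j \in D -> a j = 0.
  apply: free => j jD uDj; have /minD := asboolT uDj.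
  by move=> /(_ (subsetDl _ _))/setP/(_ j); rewrite !inE eqxx jD.
have [M [M0 /choice[a ha]]] := uD.
pose P phi := phi - \sum_(k in D) a phi k *: u k.
have Pb phi : bounded_orbit 0 (P phi).
  by exists (M * nrm phi) => n _; have [_] := ha phi; apply.
have sum0 (b : p -> K) : bounded_orbit 0 (\sum_(k in D) b k *: u k) ->
    \sum_(k in D) b k *: u k = 0.
  by move=> /free b0; apply: big1 => k kD; rewrite b0// scale0r.
(* The linearity defect is both a combination of the family and a bounded initial value, hence
   zero. *)
have PL : linear P.
  move=> l phi psi; apply/eqP; rewrite -subr_eq0.
  have dE : P (l *: phi + psi) - (l *: P phi + P psi) =
      \sum_(k in D) (l * a phi k + a psi k - a (l *: phi + psi) k) *: u k.
    rewrite /P scalerBr scaler_sumr.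
    under [RHS]eq_bigr do rewrite scalerBl scalerDl -scalerA.
    rewrite [RHS]sumrB big_split/=.
    by rewrite [X in _ - X = _]addrACA -opprD opprB [LHS]addrC subrKA.
  rewrite dE sum0// -dE; apply: bounded_orbitB => //.
  exact: bounded_orbit_linear.
pose HP := GRing.isLinear.Build K (phase X r) (phase X r) *:%R P PL.
pose P0 : {linear phase X r -> phase X r} := HB.pack P HP.
exists P0, M; split=> // [phi n|phi phib]; first by have [_] := ha phi; apply.
rewrite /= /P sum0 ?subr0//.
have -> : \sum_(k in D) a phi k *: u k = phi - P phi by rewrite /P subKr.
exact: bounded_orbitB.
Qed.

End StableProjection.
Arguments perron {R K} ofR {X r} A c.
Arguments bounded_orbit {R K} ofR {X r} A m phi.

(** * From halving to exponential decay *)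

Section ExponentialDecay.
Context {R : realType}.

(** The sequence is halved [q] times, and [D] bridges the steps from [q * l] to [N]. The factor 2
    pays for rounding [N / l] down to [q]. *)
Lemma exponential_decay (u : nat -> R) (D : R) (l N : nat) : (0 < l)%N -> 0 <= D ->
  (forall i, (i <= N)%N -> 0 <= u i) ->
  (forall i, (i <= N)%N -> u N <= D * u i) ->
  (forall i, (i + l <= N)%N -> u (i + l)%N <= u i / 2) ->
  u N <= 2 * D * expR (- (ln 2 / l%:R) * N%:R) * u 0%N.
Proof.
move=> l0 D0 u0 uD uh; pose q := (N %/ l)%N.
have qN : (q * l <= N)%N by rewrite leq_trunc_div.
have uq k : (k <= q)%N -> u (k * l)%N <= 2^-1 ^+ k * u 0%N.
  elim: k => [|k IH] kq; first by rewrite expr0 mul1r.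
  have kN : (k * l + l <= N)%N by rewrite -mulSnr (leq_trans _ qN)// leq_mul2r kq orbT.
  rewrite mulSnr (le_trans (uh _ kN))// exprS -mulrA mulrC ler_wpM2l//.
  exact: IH (ltnW kq).
rewrite (le_trans (uD _ qN))// -!mulrA mulrCA ler_wpM2l//.
rewrite (le_trans (uq _ (leqnn _)))// mulrA ler_wpM2r ?u0//.
rewrite -ler_pdivrMl// -exprS -[2^-1]lnK; last by rewrite posrE invr_gt0.
rewrite -expRM_natr ler_expR lnV ?posrE// !mulNr lerN2.
rewrite mulrAC -mulrA ler_wpM2l ?ln_ge0 ?ler1n//.
rewrite ler_pdivrMr ?ltr0n// -natrM ler_nat.
by rewrite ltnW// ltn_ceil.
Qed.

End ExponentialDecay.

(** * Uniform splitting and linear decay by weighted solutions *)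

Section ShadowingDichotomy.
Context {R : realType} {K : numFieldType} {ofR : R -> K}.
Context {hK : real_or_complex ofR} {X : normedModType K} {r : nat}.
Context {A : 'I_r.+1 -> nat -> {linear X -> X}}.
Local Notation nrm := (nrm (ofR := ofR)).
Local Notation T := (evol A).
Local Notation seg := (@segment K X r).
Local Notation bounded_orbit := (bounded_orbit ofR A).

Context {C : R} (C1 : 1 <= C) (AC : forall j n, opnorm_le (A j n) (ofR C)).
Context {c : R} (cP : perron ofR A c).
Context {P0 : {linear phase X r -> phase X r}} {M : R} (M0 : 0 <= M).
Context (P0M : forall phi n, nrm (T n 0 (P0 phi)) <= M * nrm phi).
Context (P0_id : forall phi, bounded_orbit 0 phi -> P0 phi = phi).
Local Notation g := (growth r C).
Local Notation c1 := (c + M * c).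

Lemma P0_idem phi : P0 (P0 phi) = P0 phi.
Proof. by apply: P0_id; exists (M * nrm phi). Qed.

Lemma c1_ge0 : 0 <= c1.
Proof. by have [c0 _] := cP; rewrite addr_ge0 ?mulr_ge0. Qed.

Lemma g_ge0 : 0 <= g.
Proof. exact: le_trans ler01 (growth_ge1 C1). Qed.

(** Subtracting the bounded solution started at [P0 (seg w 0)] moves the initial value into the
    kernel of [P0]; this adds [M * c] to the constant. *)
Lemma perron_ker z B : 0 <= B -> (forall n, nrm (z n) <= B) ->
  exists w, [/\ forced A z w, P0 (seg w 0) = 0 &
    forall n, nrm (seg w n) <= c1 * B].
Proof.
move=> B0 hz; have [c0 cp] := cP; have [w [zw hw]] := cp z B B0 hz.
have [sol solE] := solutionP A 0 (P0 (seg w 0)).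
set x := solution _ _ _ in sol solE.
have sE n : seg (w - x) n = seg w n - seg x n :> phase X r.
  by apply/ffunP => j; rewrite !ffunE.
exists (w - x); split=> [n||n]; rewrite sE.
- by rewrite linearB/= -sol// addrAC -zw.
- by rewrite solE linearB/= P0_idem subrr.
- rewrite (le_trans (nrmB _ _))// mulrDl lerD// -(evol_segment (k := 0%N) sol)// solE.
  by rewrite (le_trans (P0M _ _))// -mulrA ler_wpM2l.
Qed.

Definition weighted (a : int -> int) (x : int -> X) : int -> X :=
  fun t => (a t)%:~R *: x t.

(** The defect of the weighted solution at time [n] is the sum of the terms [A j n (x (n - j))]
    multiplied by [a (n + 1) - a (n - j)], so only increments of the weight matter. Before time [m]
    there is no defect, since the weight vanishes there. *)
Lemma weighted_perron m x (a : int -> int) B : 0 <= B -> is_solution A m x ->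
  m = 0%N \/ (forall t, t <= m%:Z -> a t = 0) ->
  (forall n (j : 'I_r.+1), (m <= n)%N ->
     `|a n.+1%:Z - a (n%:Z - j%:Z)|%:~R * nrm (x (n%:Z - j%:Z)) <= B) ->
  exists w, [/\ P0 (seg w 0) = 0,
    forall n, nrm (seg w n) <= c1 * (g * B) &
    forall n, seg w n - seg (weighted a x) n =
      T n 0 (seg w 0 - seg (weighted a x) 0)].
Proof.
move=> B0 sx a0 aB; pose y := weighted a x.
pose z n := y n.+1%:Z - delay_map A n (seg y n).
have yz : forced A z y by move=> n; rewrite /z addrC subrK.
have C0 : 0 <= C := le_trans ler01 C1.
have [|n|w [zw w0 wB]] := @perron_ker z (g * B); first 2 last.
- by exists w; split=> // n; exact: forced_diff zw yz n.
- by rewrite mulr_ge0// g_ge0.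
have [mn|nm] := leqP m n.
  have -> : z n = \sum_(j < r.+1)
      (a n.+1%:Z - a (n%:Z - j%:Z))%:~R *: A j n (x (n%:Z - j%:Z)).
    rewrite /z /y /weighted sx// /delay_map scaler_sumr -sumrB.
    by apply: eq_bigr => j _; rewrite !ffunE linearZ rmorphB scalerBl.
  have CB0 : 0 <= C * B by rewrite mulr_ge0.
  rewrite (le_trans (nrm_sum_le CB0 _))// => [j _|]; last first.
    by rewrite card_ord mulrA.
  have /nrm_opnorm hA := AC j n.
  rewrite nrm_int (le_trans (ler_wpM2l _ (hA _)))//.
  by rewrite mulrCA ler_wpM2l// aB.
case: a0 => [m0|a0]; first by rewrite m0 in nm.
have y0 t : t <= m%:Z -> y t = 0 by move=> tm; rewrite /y /weighted a0// scale0r.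
have -> : z n = 0; last by rewrite nrm0 mulr_ge0// g_ge0.
rewrite /z y0 ?sub0r; last by lia.
rewrite (_ : seg y n = 0) ?linear0 ?oppr0//.
by apply/ffunP => j; rewrite !ffunE y0//; lia.
Qed.

(** The difference between the response and the weighted solution is a bounded solution starting in
    the kernel of [P0], hence zero. The a priori bound [B'] thus improves to one that does not
    involve it. *)
Lemma weighted_bound m x (a : int -> int) B B' : 0 <= B -> is_solution A m x ->
  m = 0%N \/ (forall t, t <= m%:Z -> a t = 0) ->
  (forall n (j : 'I_r.+1), (m <= n)%N ->
     `|a n.+1%:Z - a (n%:Z - j%:Z)|%:~R * nrm (x (n%:Z - j%:Z)) <= B) ->
  P0 (seg (weighted a x) 0) = 0 ->
  (forall n, nrm (seg (weighted a x) n) <= B') ->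
  forall n, nrm (seg (weighted a x) n) <= c1 * (g * B).
Proof.
move=> B0 sx a0 aB y0 yB'; have [w [w0 wB wy]] := weighted_perron B0 sx a0 aB.
have d0 : seg w 0 - seg (weighted a x) 0 = 0.
  rewrite -[LHS]P0_id; first by rewrite linearB/= w0 y0 subrr.
  by exists (c1 * (g * B) + B') => n _; rewrite -wy (le_trans (nrmB _ _))// lerD.
move=> n; have := wy n; rewrite d0 linear0 => /eqP; rewrite subr_eq0 => /eqP <-.
exact: wB.
Qed.

Local Notation c3 := (c1 * g + g ^+ r * (1 + c1 * g)).

Lemma c3_ge0 : 0 <= c3.
Proof.
have h : 0 <= c1 * g := mulr_ge0 c1_ge0 g_ge0.
by rewrite addr_ge0 ?h// mulr_ge0 ?exprn_ge0 ?g_ge0// addr_ge0.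
Qed.

(** With the solution switched on only after time [m], the response [w] solves the homogeneous
    equation up to [m], and [e = - seg w 0]. After [m + r], the orbit of [phi - T m 0 e] is [w]
    itself. *)
Lemma unstable_component m phi : exists e, [/\ P0 e = 0,
  forall n, (n <= m)%N -> nrm (T n 0 e) <= c3 * nrm phi &
  forall n, (m <= n)%N -> nrm (T n m (phi - T m 0 e)) <= c3 * nrm phi].
Proof.
have [sol solE] := solutionP A m phi; set x := solution _ _ _ in sol solE.
pose a (t : int) : int := if t <= m%:Z then 0 else 1.
have [|n j mn|w [w0 wB wy]] := @weighted_perron m x a (nrm phi) (nrm_ge0 _) sol.
- by right=> t tm; rewrite /a tm.
(* The weight jumps only between [n - j <= m] and [n + 1 > m], where [x (n - j)] is an entry of
   [phi]. *)
- rewrite /a; have -> : (n.+1%:Z <= m%:Z) = false by lia.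
  case: ifPn => [jm|_]; last by rewrite subrr mul0r nrm_ge0.
  have jr : (absz (m%:Z - (n%:Z - j%:Z))%R < r.+1)%N by have := ltn_ord j; lia.
  rewrite subr0 mul1r (_ : x _ = phi (Ordinal jr)) ?le_nrm_phase//.
  by rewrite -solE ffunE/=; congr x; lia.
have yl n : (n <= m)%N -> seg (weighted a x) n = 0 :> phase X r.
  move=> nm; apply/ffunP => j; rewrite !ffunE /weighted /a.
  have -> : n%:Z - j%:Z <= m%:Z by lia.
  by rewrite mulr0z scale0r.
have yr n : (m + r < n)%N -> seg (weighted a x) n = T n m phi.
  move=> mrn; rewrite -solE (evol_segment sol) ?leqnn/=; last by lia.
  apply/ffunP => j; rewrite !ffunE /weighted /a.
  have -> : (n%:Z - j%:Z <= m%:Z) = false by have := ltn_ord j; lia.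
  by rewrite mulr1z scale1r.
have w0E n : T n 0 (seg w 0) = seg w n - seg (weighted a x) n.
  by rewrite wy yl// subr0.
have h : 0 <= c1 * g := mulr_ge0 c1_ge0 g_ge0.
have h0 : 0 <= g ^+ r * (1 + c1 * g) * nrm phi.
  by rewrite !mulr_ge0 ?exprn_ge0 ?g_ge0 ?nrm_ge0// addr_ge0.
have bl n : (n <= m)%N -> nrm (T n 0 (- seg w 0)) <= c1 * g * nrm phi.
  by move=> nm; rewrite linearN/= nrmN w0E yl// subr0 -mulrA.
exists (- seg w 0); split=> [|n nm|n mn].
- by rewrite linearN/= w0 oppr0.
- by rewrite (le_trans (bl n nm))// [leRHS]mulrDl lerDl.
(* Up to time [m + r] the segment still reaches back to where the weight is 0; these at most [r]
   steps use the growth bound, whence the second summand of [c3]. *)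
- have [mrn|nmr] := ltnP (m + r) n.
    rewrite linearB/= evol_comp// linearN/= opprK w0E yr// addrC subrK.
    by rewrite (le_trans (wB n))// mulrA [leRHS]mulrDl lerDl.
  rewrite (le_trans (nrm_evol C1 AC _ _ _))// [leRHS]mulrDl -[leLHS]add0r lerD//.
    by rewrite mulr_ge0 ?h ?nrm_ge0.
  rewrite -mulrA; apply: ler_pM; rewrite ?exprn_ge0 ?g_ge0 ?nrm_ge0//.
    by rewrite ler_weXn2l ?growth_ge1//; lia.
  by rewrite (le_trans (nrmB _ _))// [leRHS]mulrDl mul1r lerD2l bl.
Qed.

(** The difference [e - e'] has a bounded orbit, so [P0] fixes it, yet [P0] also kills it. *)
Lemma unstable_component_unique m phi e e' : P0 e = 0 -> P0 e' = 0 ->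
  bounded_orbit m (phi - T m 0 e) -> bounded_orbit m (phi - T m 0 e') -> e = e'.
Proof.
move=> e0 e0' be be'; apply/eqP; rewrite -subr_eq0 -(P0_id (phi := e - e')).
  by rewrite linearB/= e0 e0' subrr.
have dE : phi - T m 0 e' - (phi - T m 0 e) = T m 0 (e - e').
  by rewrite [RHS]linearB opprB [LHS]addrC subrKA.
have [B hB] := bounded_orbitB be' be; rewrite dE in hB.
exists (B + g ^+ m * nrm (e - e')) => n _.
have B0 : 0 <= B by rewrite (le_trans _ (hB m (leqnn m)))// nrm_ge0.
have [mn|nm] := leqP m n.
  rewrite -(@evol_comp _ _ _ _ 0%N m)// (le_trans (hB n mn))// lerDl.
  by rewrite mulr_ge0 ?nrm_ge0 ?exprn_ge0 ?g_ge0.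
rewrite (le_trans (nrm_evol C1 AC _ _ _))// -[leLHS]add0r lerD//.
by rewrite subn0 ler_wpM2r ?nrm_ge0// ler_weXn2l ?growth_ge1// ltnW.
Qed.

(** By uniqueness the unstable component of a bounded orbit is 0. *)
Lemma stable_orbit_le m phi : bounded_orbit m phi ->
  forall n, (m <= n)%N -> nrm (T n m phi) <= c3 * nrm phi.
Proof.
move=> bphi n mn; have [e [e0 _ eB]] := unstable_component m phi.
have := eB n mn; rewrite (_ : e = 0) ?linear0 ?addr0//.
apply: (unstable_component_unique (m := m) (phi := phi)) => //.
- exact: linear0.
- by exists (c3 * nrm phi).
- by rewrite linear0 subr0.
Qed.

(** By uniqueness the unstable component of [T m 0 e] is [e] itself. *)
Lemma unstable_orbit_le e : P0 e = 0 ->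
  forall n m, (n <= m)%N -> nrm (T n 0 e) <= c3 * nrm (T m 0 e).
Proof.
move=> e0 n m nm; have [e' [e'0 eB bb]] := unstable_component m (T m 0 e).
suff e'e : e' = e by move: (eB n nm); rewrite e'e.
apply: (unstable_component_unique (m := m) (phi := T m 0 e)) => //.
- by exists (c3 * nrm (T m 0 e)).
- by rewrite subrr; exact: bounded_orbit0.
Qed.

Local Notation c4 := (c1 * (g * (r.+1%:R * c3))).

(* The weight [t |-> min (max (t - m) 0) L] has bounded increments while the
   weighted orbit stays bounded, uniformly in [L], by Perron's property. *)
Lemma stable_orbit_linear_decay m phi k : bounded_orbit m phi ->
  k%:R * nrm (T (m + r + k) m phi) <= c4 * nrm phi.
Proof.
move=> bphi; have orb := stable_orbit_le bphi.
have [sol solE] := solutionP A m phi; set x := solution _ _ _ in sol solE.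
(* With this plateau the weight is at least [k] on the whole segment at time [m + r + k]. *)
pose L := (r + k)%N.
pose a (t : int) : int :=
  if t <= m%:Z then 0 else if t <= (m + L)%N%:Z then t - m%:Z else L%:Z.
have xT n : (m <= n)%N -> seg x n = T n m phi.
  by move=> mn; rewrite -solE (evol_segment sol) ?leqnn.
have xb (n : nat) (j : 'I_r.+1) : (m <= n)%N -> nrm (x (n%:Z - j%:Z)) <= c3 * nrm phi.
  move=> mn; rewrite (le_trans _ (orb n mn))// -xT//.
  by rewrite (le_trans _ (le_nrm_phase _ j))// ffunE.
have h0 : 0 <= c3 * nrm phi by rewrite mulr_ge0 ?c3_ge0 ?nrm_ge0.
have B0 : 0 <= r.+1%:R * (c3 * nrm phi) by rewrite mulr_ge0.
have L0 : 0 <= L%:R * (c3 * nrm phi) by rewrite mulr_ge0.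
have yl n : (n <= m)%N -> seg (weighted a x) n = 0 :> phase X r.
  move=> nm; apply/ffunP => j; rewrite !ffunE /weighted /a.
  have -> : n%:Z - j%:Z <= m%:Z by lia.
  by rewrite mulr0z scale0r.
have yB : forall n, nrm (seg (weighted a x) n) <=
    c1 * (g * (r.+1%:R * (c3 * nrm phi))).
  apply: (weighted_bound (m := m) (B' := L%:R * (c3 * nrm phi))) => //.
  - by right=> t tm; rewrite /a tm.
  - move=> n j mn; apply: ler_pM; rewrite ?nrm_ge0 ?ler0z//; last exact: xb.
    rewrite -[r.+1%:R]/(r.+1%:Z%:~R) ler_int; have := ltn_ord j.
    by rewrite /a; do 4?case: ifP; lia.
  - by rewrite yl// linear0.
  - move=> n; apply: nrm_phase_le => // j; have [mn|nm] := leqP m n.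
      rewrite ffunE nrm_int; apply: ler_pM; rewrite ?nrm_ge0 ?ler0z//; last exact: xb.
      by rewrite -[L%:R]/(L%:Z%:~R) ler_int /a; do 2?case: ifP; lia.
    by rewrite yl ?(ltnW nm)// ffunE nrm0.
rewrite -(mulrA c1) -(mulrA g) -(mulrA r.+1%:R); have [->|k0] := posnP k.
  by rewrite mul0r; exact: mulr_ge0 c1_ge0 (mulr_ge0 g_ge0 B0).
have kR : 0 < k%:R :> R by rewrite ltr0n.
rewrite mulrC -ler_pdivlMr//; apply: nrm_phase_le => [|j].
  by rewrite divr_ge0 ?(ltW kR) ?(le_trans _ (yB 0%N)) ?nrm_ge0.
rewrite ler_pdivlMr// mulrC (le_trans _ (yB (m + r + k)%N))//.
rewrite (le_trans _ (le_nrm_phase _ j))// -xT -?addnA ?leq_addr// !ffunE nrm_int.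
rewrite ler_wpM2r ?nrm_ge0// -[k%:R]/(k%:Z%:~R) ler_int.
by have := ltn_ord j; rewrite /a; do 2?case: ifP; lia.
Qed.

(** The weight is [m] up to time 0, then decreases to 0 at time [m]. Being constant on the initial
    segment, it keeps the initial value in the kernel of [P0]; on the segment at time [n] it is at
    least [m - n]. *)
Lemma unstable_orbit_linear_decay e n m : P0 e = 0 -> (n <= m)%N ->
  (m - n)%:R * nrm (T n 0 e) <= c4 * nrm (T m 0 e).
Proof.
move=> e0 nm; have orb := unstable_orbit_le e0.
have [sol solE] := solutionP A 0 e; set x := solution _ _ _ in sol solE.
pose a (t : int) : int := if t <= 0 then m%:Z else if t <= m%:Z then m%:Z - t else 0.
set b := nrm (T m 0 e).
have xT k : seg x k = T k 0 e.
  by rewrite -solE (evol_segment sol) ?leqnn.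
have xb (t : int) : - r%:Z <= t <= m%:Z -> nrm (x t) <= c3 * b.
  have [t0 /andP[_ tm]|t0 /andP[tr _]] := leP 0 t.
    have tm' : (`|t| <= m)%N by lia.
    rewrite (le_trans _ (orb _ _ tm'))// (le_trans _ (le_nrm_phase _ ord0))//.
    by rewrite -xT segment_ord0 gez0_abs.
  have tr' : (`|t| < r.+1)%N by lia.
  rewrite (le_trans _ (orb 0%N m _))// (le_trans _ (le_nrm_phase _ (Ordinal tr')))//.
  by rewrite -xT ffunE/= (_ : _ - _ = t)//; lia.
have b0 : 0 <= b by exact: nrm_ge0.
have h0 : 0 <= c3 * b by rewrite mulr_ge0 ?c3_ge0.
have B0 : 0 <= r.+1%:R * (c3 * b) by rewrite mulr_ge0.
have m0 : 0 <= m%:R * (c3 * b) by rewrite mulr_ge0.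
have yB : forall n, nrm (seg (weighted a x) n) <=
    c1 * (g * (r.+1%:R * (c3 * b))).
  apply: (weighted_bound (m := 0%N) (B' := m%:R * (c3 * b))) => //.
  - by left.
  - move=> k j _; have := ltn_ord j => jr.
    have [tm|mt] := leP (k%:Z - j%:Z) m%:Z; last first.
      rewrite (_ : a _ - a _ = 0) ?mul0r//.
      by rewrite /a; do 4?case: ifP; lia.
    apply: ler_pM; rewrite ?nrm_ge0 ?ler0z//; last by apply: xb; lia.
    rewrite -[r.+1%:R]/(r.+1%:Z%:~R) ler_int.
    by rewrite /a; do 4?case: ifP; lia.
  - have -> : seg (weighted a x) 0 = m%:R *: seg x 0 :> phase X r.
      apply/ffunP => j; rewrite !ffunE /weighted /a.
      by have -> : 0%:Z - j%:Z <= 0 by lia.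
    by rewrite linearZ/= xT evol_id e0 scaler0.
  - move=> k; apply: nrm_phase_le => // j; rewrite ffunE nrm_int.
    have := ltn_ord j => jr.
    have [tm|mt] := leP (k%:Z - j%:Z) m%:Z; last first.
      rewrite (_ : a _ = 0) ?mul0r//.
      by rewrite /a; do 2?case: ifP; lia.
    apply: ler_pM; rewrite ?nrm_ge0 ?ler0z//; last by apply: xb; lia.
    by rewrite -[m%:R]/(m%:Z%:~R) ler_int /a; do 2?case: ifP; lia.
rewrite -(mulrA c1) -(mulrA g) -(mulrA r.+1%:R); have [k0|k0] := posnP (m - n)%N.
  by rewrite k0 mul0r; exact: mulr_ge0 c1_ge0 (mulr_ge0 g_ge0 B0).
have kR : 0 < (m - n)%:R :> R by rewrite ltr0n.
rewrite mulrC -ler_pdivlMr//; apply: nrm_phase_le => [|j].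
  by rewrite divr_ge0 ?(ltW kR) ?(le_trans _ (yB 0%N)) ?nrm_ge0.
rewrite ler_pdivlMr// mulrC (le_trans _ (yB n))//.
rewrite (le_trans _ (le_nrm_phase _ j))// -xT !ffunE nrm_int.
rewrite ler_wpM2r ?nrm_ge0// -[(m - n)%:R]/((m - n)%N%:Z%:~R) ler_int.
by rewrite /a; do 2?case: ifP; lia.
Qed.

End ShadowingDichotomy.

(** * Construction of the dichotomy and the equivalence *)

Section Equivalence.
Context {R : realType} {K : numFieldType} {ofR : R -> K}.
Context {hK : real_or_complex ofR} {X : normedModType K} {r : nat}.
Context {A : 'I_r.+1 -> nat -> {linear X -> X}}.
Local Notation nrm := (nrm (ofR := ofR)).
Local Notation T := (evol A).

Lemma bounded_orbit_evol m n phi : (m <= n)%N -> bounded_orbit ofR A m phi ->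
  bounded_orbit ofR A n (T n m phi).
Proof.
move=> mn [M hM]; exists M => k nk; rewrite evol_comp ?mn//.
by rewrite hM// (leq_trans mn).
Qed.

Lemma shadowable_splitting (C : R) : 1 <= C ->
  (forall j n, opnorm_le (A j n) (ofR C)) -> (forall j n, compact_operator (A j n)) ->
  shadowable A ofR ->
  exists (P0 : {linear phase X r -> phase X r}) (D d : R), [/\ 0 <= D,
    forall m phi, exists e, [/\ P0 e = 0, nrm (T m 0 e) <= D * nrm phi &
      forall n, (m <= n)%N -> nrm (T n m (phi - T m 0 e)) <= D * nrm phi],
    forall m phi e e', P0 e = 0 -> P0 e' = 0 ->
      bounded_orbit ofR A m (phi - T m 0 e) ->
      bounded_orbit ofR A m (phi - T m 0 e') -> e = e',
    forall m phi, bounded_orbit ofR A m phi ->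
      (forall n, (m <= n)%N -> nrm (T n m phi) <= D * nrm phi) /\
      (forall k, k%:R * nrm (T (m + r + k) m phi) <= d * nrm phi) &
    forall e n m, P0 e = 0 -> (n <= m)%N ->
      nrm (T n 0 e) <= D * nrm (T m 0 e) /\
      (m - n)%:R * nrm (T n 0 e) <= d * nrm (T m 0 e)].
Proof.
move=> C1 AC cA /shadowable_perron[c cP].
have [P0 [M [M0 P0M P0_id]]] := stable_projection_exists C1 AC cA cP.
exists P0; do 2!eexists; split.
- refine (c3_ge0 C1 cP M0).
- move=> m phi.
  have [e [e0 el eg]] := unstable_component C1 AC cP M0 P0M P0_id m phi.
  by exists e; split=> //; exact: el _ (leqnn m).
- by move=> m phi e e'; exact: (unstable_component_unique C1 AC P0_id).
- move=> m phi bphi; split=> [n mn|k]; first exact: (stable_orbit_le C1 AC cP M0 P0M P0_id).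
  exact: (stable_orbit_linear_decay C1 AC cP M0 P0M P0_id).
- move=> e n m e0 nm; split; first exact: (unstable_orbit_le C1 AC cP M0 P0M P0_id).
  exact: (unstable_orbit_linear_decay C1 AC cP M0 P0M P0_id).
Qed.

Lemma shadowable_dichotomy (C : R) : 1 <= C ->
  (forall j n, opnorm_le (A j n) (ofR C)) -> (forall j n, compact_operator (A j n)) ->
  shadowable A ofR -> exp_dichotomy A ofR.
Proof.
move=> C1 AC cA sh.
have [P0 [D [c4 [D0 comp uniq sbd ubd]]]] := shadowable_splitting C1 AC cA sh.
(* Linear decay over [k.+1] steps then gives a factor of at most 1/2. *)
have [k ck] : exists k : nat, 2 * c4 <= k.+1%:R.
  by exists (Num.truncn (2 * c4)); rewrite ltW// Num.Theory.truncnS_gt.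
have /choice[e' e'P] (mphi : nat * phase X r) := comp mphi.1 mphi.2.
pose e m phi := e' (m, phi); have eP m phi := e'P (m, phi).
have eb m phi : bounded_orbit ofR A m (phi - T m 0 (e m phi)).
  by have [_ _ h] := eP m phi; exists (D * nrm phi).
have eE m phi psi : P0 psi = 0 -> bounded_orbit ofR A m (phi - T m 0 psi) ->
    e m phi = psi.
  by move=> psi0; apply: uniq => //; have [] := eP m phi.
(* The projection at time [m] removes the unstable component, so its kernel is the image of the
   kernel of [P0] under [T m 0]. Uniqueness of the component gives linearity. *)
have /choice[P PE] (m : nat) : exists Pm : {linear phase X r -> phase X r},
    forall phi, Pm phi = phi - T m 0 (e m phi).
  have PL : linear (fun phi => phi - T m 0 (e m phi)).
    move=> a phi psi; have -> : e m (a *: phi + psi) = a *: e m phi + e m psi.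
      apply: eE; first by rewrite linearP/=; have [-> _ _] := eP m phi;
        have [-> _ _] := eP m psi; rewrite scaler0 addr0.
      rewrite linearP/= opprD addrACA -scalerBr; exact: bounded_orbit_linear.
    by rewrite linearP/= opprD addrACA -scalerBr.
  pose HP := GRing.isLinear.Build K (phase X r) (phase X r) *:%R _ PL.
  pose Pm : {linear phase X r -> phase X r} :=
    HB.pack (fun phi : phase X r => phi - T m 0 (e m phi)) HP.
  by exists Pm.
have Pb m phi : bounded_orbit ofR A m (P m phi) by rewrite PE.
have e0 m phi : P0 (e m phi) = 0 by have [] := eP m phi.
have eT m psi : P0 psi = 0 -> e m (T m 0 psi) = psi.
  by move=> psi0; apply: eE => //; rewrite subrr; exact: bounded_orbit0.
have kerT m psi : P0 psi = 0 -> ker (P m) (T m 0 psi).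
  by move=> psi0; rewrite /ker/= PE eT// subrr.
have kerE m phi : ker (P m) phi -> phi = T m 0 (e m phi).
  by rewrite /ker/= PE => /eqP; rewrite subr_eq0 => /eqP.
have bij m n : (m <= n)%N -> set_bij (ker (P m)) (ker (P n)) (solution_op A n m).
  move=> mn; split=> [phi /kerE ->|phi psi|phi /kerE ->].
  - by rewrite evolE// evol_comp//; apply: kerT.
  - rewrite !inE => /kerE phiE /kerE psiE; rewrite phiE psiE !evolE// !evol_comp//.
    by move=> /(congr1 (e n)); rewrite !eT// => ->.
  - exists (T m 0 (e n phi)); first exact: kerT.
    by rewrite evolE// evol_comp.
have ln0 : 0 < ln 2 :> R by rewrite ln_gt0// ltr1n.
(* The stable decay estimate only starts after a delay of [r] steps. *)
pose l := (r + k.+1)%N; have l0 : (0 < l)%N by rewrite /l addnS.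
have lR : 0 < l%:R :> R by rewrite ltr0n.
have D1 : 0 < 1 + D by lra.
(* One factor [1 + D] comes from the decay along orbits, the other from the bound on the components;
   [1 + D] replaces [D] to be positive. *)
exists P, (2 * (1 + D) * (1 + D)), (ln 2 / l%:R).
have Dle (phi : phase X r) : D * nrm phi <= (1 + D) * nrm phi.
  by rewrite ler_wpM2r ?nrm_ge0//; lra.
have c4half (x y : R) : 0 <= x -> 0 <= y -> k.+1%:R * x <= c4 * y -> x <= y / 2.
  move=> x0 y0 xy; rewrite -(ler_pM2l (ltr0Sn R k)) (le_trans xy)//.
  by have := ler_wpM2r y0 ck; lra.
have combine E x y (phi : phase X r) : 0 <= E -> y <= D * nrm phi ->
    x <= 2 * (1 + D) * E * y -> x <= 2 * (1 + D) * (1 + D) * E * nrm phi.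
  move=> E0 yD /le_trans; apply.
  have -> : 2 * (1 + D) * (1 + D) * E * nrm phi = 2 * (1 + D) * E * ((1 + D) * nrm phi).
    by ring.
  by rewrite ler_wpM2l ?(le_trans yD)// !mulr_ge0// ltW.
split.
- by split; rewrite ?divr_gt0// !mulr_gt0.
- move=> n phi; rewrite [LHS]PE (eE _ _ 0) ?linear0 ?addr0//.
- move=> m n mn; split=> [phi|]; last exact: bij.
  rewrite !evolE// !PE linearB/= evol_comp//; congr (_ - T n 0 _).
  apply: eE => //; have := bounded_orbit_evol mn (Pb m phi).
  by rewrite PE linearB/= evol_comp.
- move=> m n mn; apply/nrm_opnorm => phi; rewrite evolE//; set psi := P m phi.
  have := @exponential_decay R (fun i => nrm (T (m + i) m psi)) (1 + D) l (n - m) l0.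
  rewrite subnKC// addn0 evol_id => h.
  have {h} h : nrm (T n m psi) <=
      2 * (1 + D) * expR (- (ln 2 / l%:R) * (n - m)%:R) * nrm psi.
    have bT i : bounded_orbit ofR A (m + i) (T (m + i) m psi).
      by apply: bounded_orbit_evol; [exact: leq_addr|exact: Pb].
    apply: h => [|i _|i im|i im]; [exact: ltW D1|exact: nrm_ge0| |].
      have mi : (m <= m + i <= n)%N by lia.
      rewrite (le_trans _ (Dle _))//.
      rewrite -(evol_comp _ mi) (sbd _ _ (bT i)).1//; by case/andP: mi.
    apply: c4half; rewrite ?nrm_ge0//; apply: le_trans ((sbd _ _ (bT i)).2 k.+1).
    have mi : (m <= m + i <= m + i + r + k.+1)%N by lia.
    by rewrite (evol_comp _ mi) /l !addnA.
  apply: combine h; first exact: expR_ge0.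
  by have [_ _ /(_ m (leqnn m))] := eP m phi; rewrite evol_id -PE.
- move=> m n nm; apply/nrm_opnorm => phi.
  have -> : solution_op_back A P n m (phi - P m phi) = T n 0 (e m phi).
    rewrite PE subKr -(evol_comp (m := n))//  -evolE//.
    rewrite /solution_op_back pinvKV//; last by rewrite inE; apply: kerT.
    by have [] := bij _ _ nm.
  (* On the unstable side time runs backwards from [m]. *)
  have := @exponential_decay R (fun i => nrm (T (m - i) 0 (e m phi))) (1 + D) l (m - n) l0.
  rewrite subKn// subn0 => h.
  have {h} h : nrm (T n 0 (e m phi)) <=
      2 * (1 + D) * expR (- (ln 2 / l%:R) * (m - n)%:R) * nrm (T m 0 (e m phi)).
    apply: h => [|i _|i im|i im]; [exact: ltW D1|exact: nrm_ge0| |].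
      rewrite (le_trans _ (Dle _))//.
      have ni : (n <= m - i)%N by lia.
      exact: (ubd _ _ _ (e0 m phi) ni).1.
    apply: c4half; rewrite ?nrm_ge0//.
    have li : (m - (i + l) <= m - i)%N by lia.
    apply: le_trans (ubd _ _ _ (e0 m phi) li).2; rewrite ler_wpM2r ?nrm_ge0//.
    by rewrite ler_nat /l; lia.
  apply: combine h; first exact: expR_ge0.
  by have [] := eP m phi.
Qed.

End Equivalence.

Theorem theorem3 (R : realType) (K : numFieldType) (ofR : R -> K)
    (hK : real_or_complex ofR) (X : completeNormedModType K) (r : nat)
    (A : 'I_r.+1 -> nat -> {linear X -> X})
    (A_continuous : forall j n, continuous (A j n))
    (A_compact : forall j n, compact_operator (A j n))
    (A_bounded : exists C : R, 1 <= C /\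
       forall j n, opnorm_le (A j n) (ofR C)) :
  shadowable A ofR <-> exp_dichotomy A ofR.
Proof.
have [C [C1 A_le]] := A_bounded; split.
  exact: shadowable_dichotomy C1 A_le A_compact.
exact: dichotomy_shadowable C1 A_le.
Qed.
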